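(* Let $X$ be a nonempty compact metric space and let $\phi$ be the semiflow of an impulsive dynamical system $(X,\varphi,D,I)$. Suppose that $\tau_D:\Omega_\phi\to[0,+\infty]$ is continuous and that $I(\Omega_\phi\cap D)\subset\Omega_\phi\setminus D$. Then $\phi$ has some invariant probability measure. Moreover, any $\phi$-invariant probability measure $\mu$ has its support contained in $\Omega_\phi$ and satisfies $\mu(D)=0$.
   Context: A semiflow on a metric space $X$ is a map $\phi:\mathbb{R}^+_0\times X\to X$, $\phi_t(x)=\phi(t,x)$, with $\phi_0(x)=x$ and $\phi_{t+s}(x)=\phi_t(\phi_s(x))$ for all $x\in X$, $s,t\ge 0$ (not necessarily continuous). Non-wandering set: $x\in X$ is non-wandering for $\phi$ if for every neighborhood $U$ of $x$ and any $T>0$ there exists $t\ge T$ with $\phi_t^{-1}(U)\cap U\ne\emptyset$; $\Omega_\phi$ denotes the set of all non-wandering points. Impulsive dynamical system: let $\varphi:\mathbb{R}^+_0\times X\to X$ be a continuous semiflow, $D\subset X$ a compact set and $I:D\to X$ a continuous function. Put $\tau_1(x)=\inf\{t>0:\varphi_t(x)\in D\}$ if $\varphi_t(x)\in D$ for some $t>0$, and $\tau_1(x)=+\infty$ otherwise. Assume $\tau_1(x)>0$ for all $x\in X$. The impulsive trajectory $\gamma_x$ and impulsive times $\tau_n(x)$ of $x$ are defined by: $\gamma_x(t)=\varphi_t(x)$ for $0\le t<\tau_1(x)$; if $\tau_1(x)<\infty$, then $\gamma_x(\tau_1(x))=I(\varphi_{\tau_1(x)}(x))$; inductively, as long as $\tau_n(x)<\infty$,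 $\tau_{n+1}(x)=\tau_n(x)+\tau_1(\gamma_x(\tau_n(x)))$, $\gamma_x(t)=\varphi_{t-\tau_n(x)}(\gamma_x(\tau_n(x)))$ for $\tau_n(x)<t<\tau_{n+1}(x)$, and, if $\tau_{n+1}(x)<\infty$, $\gamma_x(\tau_{n+1}(x))=I(\varphi_{\tau_{n+1}(x)-\tau_n(x)}(\gamma_x(\tau_n(x))))$. Put $T(x)=\sup_{n\ge1}\tau_n(x)$ (the supremum over all impulsive times that are defined). The tuple $(X,\varphi,D,I)$ is an impulsive dynamical system if $\tau_1(x)>0$ and $T(x)=+\infty$ for all $x\in X$. Its (impulsive) semiflow is $\phi:\mathbb{R}^+_0\times X\to X$, $\phi(t,x)=\gamma_x(t)$; it is a semiflow, not necessarily continuous. The function $\tau_D:\Omega_\phi\to[0,+\infty]$ is defined by $\tau_D(x)=\tau_1(x)$ if $x\in\Omega_\phi\setminus D$ and $\tau_D(x)=0$ if $x\in\Omega_\phi\cap D$; here $[0,+\infty]$ carries the one-point compactification topology and $\Omega_\phi$ the subspace topology. Invariant measures: a Borel probability measure $\mu$ on $X$ is $\phi$-invariant if $\phi$ is Borel measurable and $\mu(\phi_t^{-1}(A))=\mu(A)$ for every Borel set $A\subset X$ and every $t\ge0$. The support of $\mu$ is the set of $x\in X$ such that $\mu(U)>0$ for every neighborhood $U$ of $x$. *)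

(* Defs.v *)
From HB Require Import structures.
From mathcomp Require Import all_boot all_order all_algebra.
From mathcomp Require Import all_classical all_reals all_analysis.
Import Order.TTheory GRing.Theory Num.Theory.
Import numFieldNormedType.Exports.

Set Implicit Arguments.
Unset Strict Implicit.
Unset Printing Implicit Defensive.

Local Open Scope classical_set_scope.
Local Open Scope ring_scope.

(* Nonempty metric spaces: the base point is what lets the Borel sigma-algebra
   be a measurableType. *)
#[short(type="pmetricType")]
HB.structure Definition PointedMetric (K : numDomainType) :=
  { M of Metric K M & isPointed M }.

Notation borel T := (g_sigma_algebraType (@open T)).

(* Semiflows are total functions on R * X; only their values at times t >= 0
   ever matter. *)
Definition semiflow (R : realType) (X : Type) (f : R -> X -> X) : Prop :=
  (forall x, f 0 x = x) /\
  (forall s t x, 0 <= s -> 0 <= t -> f (t + s) x = f t (f s x)).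

Definition nonneg_time (R : realType) (X : Type) : set (R * X) :=
  [set p | 0 <= p.1].
Arguments nonneg_time : clear implicits.

Definition continuous_semiflow (R : realType) (X : topologicalType)
    (f : R -> X -> X) : Prop :=
  semiflow f /\
  {within nonneg_time R X, continuous (fun p : R * X => f p.1 p.2)}.

Definition nonwandering (R : realType) (X : topologicalType)
    (f : R -> X -> X) : set X :=
  [set x | forall U, nbhs x U -> forall T, 0 < T ->
     exists2 t, T <= t & (f t @^-1` U) `&` U !=set0].

Section impulsive.
Context {R : realType} {X : pmetricType R}.
Variables (flow : R -> X -> X) (D : set X) (I : X -> X).
Local Open Scope ereal_scope.

(* The infimum of the empty set is +oo. *)
Definition tau1 (x : X) : \bar R :=
  ereal_inf [set t%:E | t in [set t : R | (0 < t)%R /\ D (flow t x)]].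

(* The value of the trajectory of x at its n-th impulsive time (x itself for
   n = 0); unspecified when that time is +oo. *)
Fixpoint impulse_point (x : X) (n : nat) : X :=
  if n is m.+1 then
    let y := impulse_point x m in I (flow (fine (tau1 y)) y)
  else x.

(* The n-th impulsive time, and 0 for n = 0. Impulsive times that are not
   defined, because an earlier one is +oo, are set to +oo. *)
Fixpoint impulse_time (x : X) (n : nat) : \bar R :=
  if n is m.+1 then impulse_time x m + tau1 (impulse_point x m) else 0.

Definition lifetime (x : X) : \bar R :=
  ereal_sup [set impulse_time x n | n in [set n | (1 <= n)%N]].

Definition impulse_count (x : X) (t : R) : nat :=
  xget 0%N [set n | impulse_time x n <= t%:E < impulse_time x n.+1].

(* See impulsive_trajectoryE and impulsive_trajectory_jump below for the
   defining equations. *)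
Definition impulsive_trajectory (x : X) (t : R) : X :=
  let n := impulse_count x t in
  flow (t - fine (impulse_time x n))%R (impulse_point x n).

Definition impulsive_semiflow (t : R) (x : X) : X := impulsive_trajectory x t.

(* I is a total function; only its restriction to D matters. *)
Definition impulsive_dynamical_system : Prop :=
  [/\ continuous_semiflow flow, compact D, {within D, continuous I},
      forall x, 0 < tau1 x & forall x, lifetime x = +oo].

(* To be restricted to the nonwandering set of impulsive_semiflow. Its values
   are in [0, +oo], on which the topology of \bar R induces that of the
   one-point compactification of [0, +oo[. *)
Definition tauD (x : X) : \bar R := if x \in D then 0 else tau1 x.

Lemma tau1_ge0 x : 0 <= tau1 x.
Proof. by apply: le_ereal_inf_tmp => _ [t [/ltW t0 _] <-]; rewrite lee_fin. Qed.

Lemma impulse_time_ndecr x : nondecreasing_seq (impulse_time x).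
Proof. by apply/nondecreasing_seqP => n /=; rewrite leeDl// tau1_ge0. Qed.

Lemma impulse_countE x n t :
  impulse_time x n <= t%:E < impulse_time x n.+1 -> impulse_count x t = n.
Proof.
move=> /andP[nt tn]; apply: xget_unique => [|m /andP[mt tm]].
  by apply/andP; split.
apply/eqP; rewrite eqn_leq; apply/andP; split; rewrite leqNgt; apply/negP => h.
- by have := lt_le_trans tn (le_trans (impulse_time_ndecr x h) mt); rewrite ltxx.
- by have := lt_le_trans tm (le_trans (impulse_time_ndecr x h) nt); rewrite ltxx.
Qed.

Lemma impulsive_trajectoryE x n t :
  impulse_time x n <= t%:E < impulse_time x n.+1 ->
  impulsive_trajectory x t =
    flow (t - fine (impulse_time x n))%R (impulse_point x n).
Proof. by move=> nt; rewrite /impulsive_trajectory (impulse_countE nt). Qed.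

Lemma impulsive_trajectory_time x n t :
  semiflow flow -> (forall y, 0 < tau1 y) -> impulse_time x n = t%:E ->
  impulsive_trajectory x t = impulse_point x n.
Proof.
move=> [flow0 _] tau1_gt0 nt.
rewrite (@impulsive_trajectoryE x n); first by rewrite nt/= subrr flow0.
by rewrite /= nt lexx/= lteDl.
Qed.

Lemma impulsive_trajectory_jump x n s t :
  semiflow flow -> (forall y, 0 < tau1 y) ->
  impulse_time x n = s%:E -> impulse_time x n.+1 = t%:E ->
  impulsive_trajectory x t = I (flow (t - s)%R (impulsive_trajectory x s)).
Proof.
move=> fflow tau1_gt0 ns nt.
rewrite (impulsive_trajectory_time fflow tau1_gt0 nt).
rewrite (impulsive_trajectory_time fflow tau1_gt0 ns) /=.
have := tau1_gt0 (impulse_point x n); move: nt; rewrite /= ns.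
by case: tau1 => [r| |]//= [<-] _; rewrite addrAC subrr add0r.
Qed.

End impulsive.

Section invariant_probability.
Context {R : realType} {X : pmetricType R}.
Local Open Scope ereal_scope.

(* Joint measurability on [0, +oo[ * X. *)
Definition borel_measurable_semiflow (f : R -> X -> X) : Prop :=
  @measurable_fun _ _ (borel (R * X)%type) (borel X) (nonneg_time R X)
    (fun p => f p.1 p.2).

Definition invariant_probability (f : R -> X -> X)
    (mu : probability (borel X) R) : Prop :=
  borel_measurable_semiflow f /\
  forall (A : set (borel X)) (t : R), measurable A -> (0 <= t)%R ->
    mu (f t @^-1` A) = mu A.

(* Neighborhoods are required to be Borel since mu is unspecified on sets that
   are not measurable. *)
Definition measure_support (mu : probability (borel X) R) : set X :=
  [set x | forall U : set X, nbhs x U -> measurable (U : set (borel X)) ->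
     0 < mu U].

End invariant_probability.

(* Main.v *)
Require Import Defs.
From HB Require Import structures.
From mathcomp Require Import all_boot all_order all_algebra.
From mathcomp Require Import all_classical all_reals all_analysis.
From mathcomp Require Import measurable_realfun lra.
Import Order.TTheory GRing.Theory Num.Theory.
Import numFieldNormedType.Exports.

Set Implicit Arguments.
Unset Strict Implicit.
Unset Printing Implicit Defensive.

(** Write phi for the impulsive semiflow, Omega for its nonwandering set and
    Y for Omega minus D.

    The time tau1 is lower semicontinuous off D, so before its first impulse the
    trajectory of a point off D depends continuously on the point, and it stays
    in Omega if it starts there. Since I sends the points of Omega in D back to
    Y, each phi_t maps Y into Y (nonwandering_setD_invariant).

    Support and mass of D. An open set whose points do not return to it after
    some time T has infinitely many disjoint preimages, all of the same mass,
    hence is null (wandering_null); so an invariant mu is carried by Omega. As Y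
    is invariant, a point of Omega that phi_t sends into D lies in D, and its
    tau1 is at most t. Hence mu D = mu (phi_t^-1 D) is at most the mass of the
    points of Omega in D with tau1 <= t, and this tends to 0 with t because tau1 > 0
    (measure_impulse_set).

    Existence. The maps phi_t jump, but they become continuous on Omega once
    each x of Omega in D is glued to I x. This is where the continuity of tauD
    enters: a point of Omega close to x reaches D after a short time, and is
    then sent close to I x. The glued space is compact and phi has an invariant
    probability on it; moving the mass of D along I brings it back to Y. The
    proof below follows this idea without building the quotient space:

    - the functions on the glued space are the glued functions, continuous on
      Omega with f (I x) = f x on D. With reset the map that sends x to I x on D
      and fixes the other points, f \o phi t \o reset is glued when f is
      (glued_impulsive_semiflow), and each closed subset of Y is the trace on Y
      of a set [f <= 0] with f glued (glued_zero_set);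
    - averaging along the orbit of a point of Y gives a finitely additive
      probability m on all subsets of X that is invariant under every phi_t and
      carried by Y (invariant_mean);
    - m is turned into a Borel probability nu with nu U <= m U for U open
      (borel_probability_of_mean). Comparing nu with m on closed and open
      sublevel sets, the invariance of m gives that [f <= a] and
      [f \o phi t \o reset <= a] have the same nu-mass in Omega for f glued
      (eq_sublevel);
    - the invariant probability is the image mu of nu under reset. For f glued
      with [f <= 0] of trace K on Y, the previous equality at a = 0 reads
      mu (phi_t^-1 K) = mu K, and the masses of the closed subsets K of Y
      determine the image of mu under phi_t (probability_unique_closed_setD). *)

Local Open Scope classical_set_scope.
Local Open Scope ring_scope.

(** * Finitely additive probabilities *)

Section mean.
Context {R : realType} {T : Type}.
Implicit Types (m : set T -> R) (A B : set T).

(** The set-function form of a mean on bounded functions: unlike a Borel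
    probability it is defined on every subset, so that it can be obtained as a
    limit along an ultrafilter. *)
Definition mean m : Prop :=
  [/\ forall A, 0 <= m A, m setT = 1 &
      forall A B, A `&` B = set0 -> m (A `|` B) = m A + m B].

Variable m : set T -> R.
Hypothesis mP : mean m.

Lemma mean_ge0 A : 0 <= m A. Proof. by case: mP. Qed.

Lemma mean_additive A B : A `&` B = set0 -> m (A `|` B) = m A + m B.
Proof. by case: mP => _ _; apply. Qed.

Lemma mean_setC A : m (~` A) = 1 - m A.
Proof.
by case: mP => _ <- _; rewrite -(setUv A) mean_additive ?setICr// addrAC subrr add0r.
Qed.

Lemma le_mean A B : A `<=` B -> m A <= m B.
Proof.
move=> AB; rewrite -(setUIDK B A) (setIidr AB) mean_additive; last first.
  by rewrite setDE setICA setICr setI0.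
by rewrite lerDl mean_ge0.
Qed.

Lemma mean_le1 A : m A <= 1.
Proof. by case: mP => _ <- _; exact: le_mean. Qed.

Lemma mean_set0 : m set0 = 0.
Proof. by rewrite -setCT mean_setC; case: mP => _ -> _; rewrite subrr. Qed.

Lemma mean_setU A B : m (A `|` B) <= m A + m B.
Proof.
rewrite -(setDUK (@subsetUl _ A B)) mean_additive ?setDIK// lerD2l le_mean//.
by move=> x [[]].
Qed.

Lemma mean_bigsetU n (F : (set T)^nat) :
  m (\big[setU/set0]_(i < n) F i) <= \sum_(i < n) m (F i).
Proof.
elim: n => [|n ih]; first by rewrite !big_ord0 mean_set0.
by rewrite !big_ord_recr/= (le_trans (mean_setU _ _))// lerD2r.
Qed.

Lemma mean_setIr A B : m B = 1 -> m (A `&` B) = m A.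
Proof.
move=> mB; apply/eqP; rewrite eq_le le_mean//=.
rewrite -{1}(setUIDK A B) (le_trans (mean_setU _ _))// gerDl.
by rewrite (le_trans (le_mean (_ : _ `<=` ~` B)))// ?mean_setC ?mB ?subrr// => x [].
Qed.


End mean.

(** * Borel probabilities dominated by a mean on open sets *)

Section borel_regularization.
Context {R : realType} {X : pmetricType R}.
Hypothesis cX : compact [set: X].
Variable m : set X -> R.
Hypothesis mP : mean m.
Local Open Scope ereal_scope.

(** A closed inner approximation of U, close to the set of points at distance at
    least 1 / n.+1 from the complement. The interiors of the balls make it
    closed by construction. *)
Definition shrink (U : set X) (n : nat) : set X :=
  ~` \bigcup_(y in ~` U) (ball y n.+1%:R^-1)°.

Lemma closed_shrink U n : closed (shrink U n).
Proof.
by apply: open_closedC; apply: bigcup_open => y _; exact: open_interior.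
Qed.

Lemma shrink_subset U n : shrink U n `<=` U.
Proof.
move=> x; apply: contra_notP => nUx; exists x => //.
exact: nbhsx_ballx.
Qed.

(** Stated with x' and n varying together, which is what the near-covering form of
    compactness consumes. *)
Lemma near_shrink (U : set X) x : open U -> U x ->
  \forall x' \near x & n \near \oo, shrink U n x'.
Proof.
move=> oU Ux; have [e /= e0 xeU] : nbhs_ball x U by rewrite nbhs_ballE; exact: open_nbhs_nbhs.
exists (ball x (e / 2), [set n | n.+1%:R^-1 < e / 2 :> R]%R) => /=.
  split; first by apply: nbhsx_ballx; rewrite divr_gt0.
  have e20 : (0 < e / 2)%R by rewrite divr_gt0.
  exact: (near_infty_natSinv_lt (PosNum e20)).
move=> [x' n]/= [xx' ne] [y nUy /interior_subset yx'].
apply: nUy; apply: xeU; apply: (ball_split xx'); apply: ball_sym.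
exact: le_ball (ltW ne) _ yx'.
Qed.

(** Compactness gives more than a finite subcover: the members of the subcover
    can be shrunk to closed sets, on which a mean can be compared with the inner
    content below. *)
Lemma closed_subset_bigcup_open (U : (set X)^nat) K :
  (forall i, open (U i)) -> closed K -> K `<=` \bigcup_i U i ->
  exists n (F : (set X)^nat), [/\ forall i, closed (F i),
    forall i, F i `<=` U i & K `<=` \big[setU/set0]_(i < n) F i].
Proof.
move=> oU cK KU; have /compact_near_coveringP cptK : compact K.
  exact: subclosed_compact cK cX _.
have [] := cptK nat \oo (fun n x => exists2 i, (i < n)%N & shrink (U i) n x).
  move=> x /KU[i _ Uix].
  have [[V N] /= [xV NN] VN] := near_shrink (oU i) Uix.
  exists (V, N `&` [set n | (i < n)%N]) => /=.
    split=> //; apply: filterI NN _; exact: nbhs_infty_gt.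
  by move=> [y n]/= [Vy [Nn ni]]; exists i => //; exact: (VN (y, n)).
move=> n _ /(_ n (leqnn n)) Kn; exists n, (fun i => shrink (U i) n).
split=> [i|i|x /Kn[i ni ?]]; [exact: closed_shrink|exact: shrink_subset|].
by rewrite -(bigcup_mkord n (fun i => shrink (U i) n)); exists i.
Qed.

(** A mean is not continuous along increasing unions of open sets. Its inner
    regularization by closed sets is, and this is what makes the outer content
    below countably subadditive. *)
Definition open_content (U : set X) : \bar R :=
  ereal_sup [set (m K)%:E | K in [set K | closed K /\ K `<=` U]].

Definition outer_content (A : set X) : \bar R :=
  ereal_inf [set open_content U | U in [set U | open U /\ A `<=` U]].

Lemma open_content_ge K U : closed K -> K `<=` U -> (m K)%:E <= open_content U.
Proof. by move=> cK KU; apply: ereal_sup_ubound; exists K. Qed.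

Lemma open_content_le U : open_content U <= (m U)%:E.
Proof.
by apply: ge_ereal_sup => _ [K [_ KU] <-]; rewrite lee_fin le_mean.
Qed.

Lemma open_content_ge0 U : 0 <= open_content U.
Proof.
have -> : 0 = (m set0)%:E by rewrite (mean_set0 mP).
by apply: open_content_ge; [exact: closed0|].
Qed.

Lemma open_content_fin U : open_content U \is a fin_num.
Proof.
rewrite ge0_fin_numE ?open_content_ge0//.
by rewrite (le_lt_trans (open_content_le U))// ltry.
Qed.

Lemma le_open_content U V : U `<=` V -> open_content U <= open_content V.
Proof.
move=> UV; apply: ge_ereal_sup => _ [K [cK KU] <-].
by apply: open_content_ge => //; exact: subset_trans UV.
Qed.

(** By compactness, a closed subset of the union is covered by finitely many
    closed sets F i with F i in U i, and finite subadditivity of m concludes. *)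
Lemma open_content_bigcup (U : (set X)^nat) : (forall i, open (U i)) ->
  open_content (\bigcup_i U i) <= \sum_(0 <= i <oo) open_content (U i).
Proof.
move=> oU; apply: ge_ereal_sup => _ [K [cK KU] <-].
have [n [F [cF FU KF]]] := closed_subset_bigcup_open oU cK KU.
apply: (@le_trans _ _ (\sum_(0 <= i < n) open_content (U i))); last first.
  by apply: nneseries_lim_ge => i _ _; exact: open_content_ge0.
apply: (@le_trans _ _ (\sum_(i < n) m (F i))%:E).
  rewrite lee_fin; apply: le_trans (le_mean mP KF) _.
  exact: (mean_bigsetU mP).
rewrite big_mkord -sumEFin; apply: lee_sum => i _.
by apply: open_content_ge.
Qed.

Lemma open_content_setT : open_content setT = 1.
Proof.
apply/eqP; rewrite eq_le; case: mP => _ m1 _; rewrite -m1.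
by rewrite open_content_le/= open_content_ge//; exact: closedT.
Qed.

Lemma outer_content_open U : open U -> outer_content U = open_content U.
Proof.
move=> oU; apply/eqP; rewrite eq_le; apply/andP; split.
  by apply: ereal_inf_lbound; exists U => //; split.
by apply: le_ereal_inf_tmp => _ [V [oV UV] <-]; exact: le_open_content.
Qed.

Lemma outer_content_le A U : open U -> A `<=` U ->
  outer_content A <= open_content U.
Proof. by move=> oU AU; apply: ereal_inf_lbound; exists U. Qed.

Let outer_content0 : outer_content set0 = 0.
Proof.
rewrite outer_content_open; last exact: open0.
apply/eqP; rewrite eq_le open_content_ge0 andbT.
by rewrite (le_trans (open_content_le _))// (mean_set0 mP).
Qed.

Let outer_content_ge0 A : 0 <= outer_content A.
Proof.
by apply: le_ereal_inf_tmp => _ [U _ <-]; exact: open_content_ge0.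
Qed.

Let le_outer_content : {homo outer_content : A B / A `<=` B >-> A <= B}.
Proof.
move=> A B AB; apply: le_ereal_inf_tmp => _ [U [oU BU] <-].
by apply: outer_content_le => //; exact: subset_trans BU.
Qed.

Let outer_content_fin A : outer_content A \is a fin_num.
Proof.
rewrite ge0_fin_numE//.
rewrite (le_lt_trans (outer_content_le openT (@subsetT _ A)))//.
by rewrite open_content_setT ltry.
Qed.

Let outer_content_sigma_subadditive : sigma_subadditive outer_content.
Proof.
move=> F; apply/lee_addgt0Pr => e e0.
have /(_ _)/cid2-/all_sig2[U] : forall i, exists2 U, open U /\ F i `<=` U &
    open_content U <= outer_content (F i) + (e / (2 ^ i.+1)%:R)%:E.
  move=> i; have e2 : (0 < e / (2 ^ i.+1)%:R)%R by rewrite divr_gt0// ltr0n expn_gt0.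
  have [_ [U oFU <-] /ltW ?] := lb_ereal_inf_adherent e2 (outer_content_fin (F i)).
  by exists U.
move=> oFU Ue.
apply: (@le_trans _ _ (\sum_(0 <= i <oo) open_content (U i))).
  apply: le_trans (open_content_bigcup _); last by move=> i; have [] := oFU i.
  apply: outer_content_le; first by apply: bigcup_open => i _; have [] := oFU i.
  by move=> x [i _ Fix]; exists i => //; have [_] := oFU i; apply.
apply: le_trans (epsilon_trick xpredT _ (ltW e0)) => //.
by apply: lee_nneseries => // i *; exact: open_content_ge0.
Qed.

HB.instance Definition _ := isOuterMeasure.Build R X outer_content
  outer_content0 outer_content_ge0 le_outer_content
  outer_content_sigma_subadditive.

(** Given an open V containing the test set, exhaust V `&` U from inside by a
    closed K, then the open set V minus K by a closed L. As K and L are disjoint,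
    m K + m L = m (K `|` L) is at most the content of V. *)
Lemma open_caratheodory U : open U -> outer_content.-caratheodory U.
Proof.
move=> oU; apply: le_caratheodory_measurable => A.
apply: le_ereal_inf_tmp => _ [V [oV AV] <-].
apply/lee_addgt0Pr => e e0; have e20 : (0 < e / 2)%R by rewrite divr_gt0.
have oVU : open (V `&` U) by exact: openI.
have [_ [K [cK KVU] <-] Ke] :=
  ub_ereal_sup_adherent e20 (open_content_fin (V `&` U)).
have [_ [L [cL LVK] <-] Le] :=
  ub_ereal_sup_adherent e20 (open_content_fin (V `&` ~` K)).
have oVK : open (V `&` ~` K) by apply: openI => //; exact: closed_openC.
have -> : e = (e / 2 + e / 2)%R by rewrite -splitr.
have KL : K `&` L = set0.
  by apply/seteqP; split => // x [Kx /LVK[_]].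
apply: (@le_trans _ _ ((m (K `|` L))%:E + (e / 2 + e / 2)%:E)); last first.
  rewrite leeD2r// open_content_ge//; first exact: closedU.
  by rewrite subUset; split; [move=> x /KVU[]|move=> x /LVK[]].
have [_ _ ->//] := mP; rewrite !EFinD addeACA.
apply: leeD.
  apply: (@le_trans _ _ (open_content (V `&` U))).
    by apply: outer_content_le => //; exact: setSI.
  by rewrite -leeBlDr// ltW.
apply: (@le_trans _ _ (open_content (V `&` ~` K))).
  apply: outer_content_le => // x [Ax nUx]; split; first exact: AV.
  by move=> /KVU[].
by rewrite -leeBlDr// ltW.
Qed.

Let borel_caratheodory (A : set (borel X)) :
  measurable A -> outer_content.-caratheodory A.
Proof.
apply: smallest_sub; last exact: open_caratheodory.
exact: (@sigma_algebra_measurable _ (caratheodory_type outer_content)).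
Qed.

(** An alias of the outer content, typed so that the measure structure is the one
    on Borel sets and not the one on Caratheodory-measurable sets. *)
Definition borel_of_mean : set (borel X) -> \bar R := outer_content.

Let borel_of_mean_semi_sigma_additive : semi_sigma_additive borel_of_mean.
Proof.
move=> F mF tF mUF.
apply: (@caratheodory_measure_sigma_additive _ _ outer_content) => //.
  by move=> i; exact: borel_caratheodory.
exact: borel_caratheodory.
Qed.

HB.instance Definition _ := isMeasure.Build _ (borel X) R borel_of_mean
  outer_content0 outer_content_ge0 borel_of_mean_semi_sigma_additive.

Let borel_of_mean_setT : borel_of_mean setT = 1.
Proof. by rewrite -open_content_setT; exact: outer_content_open openT. Qed.

HB.instance Definition _ := Measure_isProbability.Build _ (borel X) R
  borel_of_mean borel_of_mean_setT.

(** The inequality says that mass of m may escape to the boundary of an open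
    set: nu is a weak limit of the averages of which m is the limit. *)
Lemma borel_probability_of_mean : exists nu : probability (borel X) R,
  forall U : set X, open U -> nu U <= (m U)%:E.
Proof.
exists borel_of_mean => U oU; apply: le_trans (open_content_le U).
by rewrite -outer_content_open.
Qed.

End borel_regularization.

(** * Invariant means for commuting maps *)

Lemma ultra_fmap {T U : Type} (f : T -> U) (G : set_system T) :
  UltraFilter G -> UltraFilter (f @ G).
Proof.
move=> UG; split; first exact: fmap_proper_filter.
move=> H PH GH; apply/seteqP; split => // A HA.
have [//|GnA] := in_ultra_setVsetC (f @^-1` A) UG.
exfalso; apply: (@filter_not_empty _ H); rewrite -(setICr A).
by apply: filterI => //; exact: GH.
Qed.

Lemma ultra_cvg_itv {R : realType} {T : Type} (G : set_system T) (h : T -> R) a b :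
  UltraFilter G -> (forall x, a <= h x <= b) -> cvg (h @ G).
Proof.
move=> UG hab; have := @segment_compact R a b; rewrite compact_ultra.
move=> /(_ (h @ G) (ultra_fmap _ UG)); case; last by move=> l [_ hl]; apply/cvg_ex; exists l.
have PG : ProperFilter G by exact: ultra_proper.
by apply: (@filterS _ G _ setT) => [x _|]; [rewrite /= in_itv/= hab|exact: filterT].
Qed.

Section invariant_mean.
Context {R : realType} {P : eqType} {T : Type}.
Variable f : P -> T -> T.
Hypothesis fC : forall s t x, f s (f t x) = f t (f s x).

(** The average of g over the points obtained from x by applying the maps of s
    at most n times each, counted with multiplicity. *)
Fixpoint box_average (s : seq P) (n : nat) (g : T -> R) (x : T) : R :=
  if s is t :: s' then
    n.+1%:R^-1 * \sum_(j < n.+1) box_average s' n g (iter j (f t) x)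
  else g x.

Let iter_comm t s j x : iter j (f t) (f s x) = f s (iter j (f t) x).
Proof. by elim: j => //= j ->. Qed.

Lemma box_average_shift s n g t x :
  box_average s n (g \o f t) x = box_average s n g (f t x).
Proof.
elim: s x => //= u s ih x; congr (_ * _); apply: eq_bigr => j _.
by rewrite ih iter_comm.
Qed.

Lemma box_averageD s n g h x :
  box_average s n (g \+ h) x = box_average s n g x + box_average s n h x.
Proof.
elim: s x => //= u s ih x; rewrite -mulrDr -big_split/=; congr (_ * _).
by apply: eq_bigr => j _.
Qed.

Lemma box_average_cst (A : set T) s n g c x :
  A x -> (forall t y, A y -> A (f t y)) -> (forall y, A y -> g y = c) ->
  box_average s n g x = c.
Proof.
move=> + fA gc; elim: s x => [|u s ih] x Ax /=; first exact: gc.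
rewrite (eq_bigr (fun=> c)) => [|j _]; last first.
  by apply: ih; elim: (nat_of_ord j) => //= k; exact: fA.
by rewrite sumr_const card_ord -[c *+ _]mulr_natl mulrA mulVf ?mul1r ?pnatr_eq0.
Qed.

Lemma box_average_itv s n g x :
  (forall y, 0 <= g y <= 1) -> 0 <= box_average s n g x <= 1.
Proof.
move=> g01; elim: s x => //= u s ih x; apply/andP; split.
  by rewrite mulr_ge0// sumr_ge0// => j _; have /andP[] := ih (iter j (f u) x).
rewrite mulrC ler_pdivrMr ?ltr0n// mul1r.
apply: (@le_trans _ _ (\sum_(j < n.+1) 1)).
  by apply: ler_sum => j _; have /andP[] := ih (iter j (f u) x).
by rewrite sumr_const card_ord.
Qed.

(** For the head of s the sum over j telescopes, and only the two end terms
    survive, divided by n.+1; for the other maps of s, commutation moves t inside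
    the average, where induction applies. *)
Lemma box_average_almost_invariant s n g t x :
  (forall y, 0 <= g y <= 1) -> t \in s ->
  `|box_average s n g (f t x) - box_average s n g x| <= n.+1%:R^-1.
Proof.
move=> g01; elim: s x => //= u s ih x; rewrite inE => /orP[/eqP ->|ts].
  rewrite -mulrBr normrM ger0_norm ?invr_ge0// ger_pMr ?invr_gt0 ?ltr0n//.
  rewrite [X in X - _]big_ord_recr big_ord_recl/= -iterSr.
  under eq_bigr do rewrite -iterSr.
  have telescope (A B C D : R) : D = A -> A + B - (C + D) = B - C.
    by move=> ->; lra.
  rewrite telescope//.
  have /andP[a0 a1] := box_average_itv s n (iter n.+1 (f u) x) g01.
  have /andP[b0 b1] := box_average_itv s n x g01.
  by rewrite ler_norml; apply/andP; split; lra.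
rewrite -mulrBr normrM ger0_norm ?invr_ge0// -[leRHS]mulr1 ler_pM2l ?invr_gt0 ?ltr0n//.
rewrite -sumrB (le_trans (ler_norm_sum _ _ _))//.
apply: (@le_trans _ _ (\sum_(j < n.+1) n.+1%:R^-1)).
  by apply: ler_sum => j _; rewrite iter_comm; exact: ih.
by rewrite sumr_const card_ord -[_ *+ _]mulr_natl mulfV// pnatr_eq0.
Qed.

Let F : set_system (seq P * nat) :=
  filter_from [set: seq P * nat]
    (fun p => [set q | {subset p.1 <= q.1} /\ (p.2 <= q.2)%N]).

Let F_proper : ProperFilter F.
Proof.
apply: filter_from_proper; last by move=> p _; exists p; split.
apply: filter_fromT_filter; first by exists ([::], 0%N).
move=> p q; exists (p.1 ++ q.1, maxn p.2 q.2) => -[s n] /= [sub].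
rewrite geq_max => /andP[pn qn]; split; split => // t tpq.
  by apply: sub; rewrite mem_cat tpq.
by apply: sub; rewrite mem_cat tpq orbT.
Qed.

(** Abelian semigroups are amenable: the limit of box_average along an ultrafilter
    for which the list of maps and the length of the box both grow is invariant
    under each map. The ultrafilter handles all maps at once, so that for a
    semiflow the invariance holds at every time, and not only at countably many.
    The last clause holds because the averages only see the orbit of x. *)
Lemma invariant_mean x : exists m : set T -> R,
  [/\ mean m, forall t A, m (f t @^-1` A) = m A &
      forall A, A x -> (forall t y, A y -> A (f t y)) -> m A = 1].
Proof.
have [G [UG FG]] := ultraFilterLemma F_proper.
pose av (A : set T) (p : seq P * nat) := box_average p.1 p.2 \1_A x.
have i01 (A : set T) y : 0 <= (\1_A y : R) <= 1.
  by rewrite indicE; case: (_ \in _); rewrite ?lexx ?ler01.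
have av01 A p : 0 <= av A p <= 1 by apply: box_average_itv; exact: i01.
have avc A : cvg (av A @ G) by apply: (ultra_cvg_itv UG (av01 A)).
have PG : ProperFilter G by exact: ultra_proper.
exists (fun A => lim (av A @ G)); split.
- split=> [A||A B AB].
  + by apply: limr_ge => //; near=> p; have /andP[] := av01 A p.
  + apply: cvg_lim => //; rewrite (_ : av setT = cst 1); first exact: cvg_cst.
    apply/funext => p; apply: (@box_average_cst setT) => // y _.
    by rewrite indicT.
  + rewrite -limD//; congr (lim (_ @ G)); apply/funext => p.
    transitivity (box_average p.1 p.2 (\1_A \+ \1_B) x : R); last exact: box_averageD.
    congr (box_average _ _ _ _).
    apply/funext => y /=; rewrite !indicE in_setU.
    have [yA|] := boolP (y \in A) => /=; last by rewrite add0r.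
    case: (boolP (y \in B)); last by rewrite addr0.
    move: yA; rewrite !inE => yA yB.
    by have : set0 y; [rewrite -AB|].
- move=> t A; apply/eqP; rewrite -subr_eq0; apply/eqP; rewrite -limB//.
  apply: cvg_lim => //; apply/cvgrPdist_le => e e0.
  (* A box of length n >= N makes the error n.+1%:R^-1 at most e. *)
  pose N := Num.truncn e^-1.
  apply: FG; exists ([:: t], N) => // -[s n] /= [sub Nn]; rewrite sub0r normrN.
  have shift : av (f t @^-1` A) (s, n) = box_average s n \1_A (f t x).
    by rewrite -box_average_shift.
  rewrite [X in `|X|](_ : _ = av (f t @^-1` A) (s, n) - av A (s, n))// shift.
  apply: (@le_trans _ _ n.+1%:R^-1).
  + apply: box_average_almost_invariant; first exact: i01.
    by apply: sub; rewrite inE.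
  + rewrite -[e]invrK lef_pV2 ?posrE ?invr_gt0//.
    apply: (@le_trans _ _ N.+1%:R); last by rewrite ler_nat.
    by apply/ltW; exact: truncnS_gt.
- move=> A Ax fA; apply: cvg_lim => //.
  rewrite (_ : av A = cst 1); first exact: cvg_cst.
  apply/funext => p; apply: (@box_average_cst A) => // y Ay.
  by rewrite indicE mem_set.
Unshelve. all: by end_near. Qed.

End invariant_mean.

(** * Borel sets and Borel probabilities *)

Section borel.
Context {T : ptopologicalType}.

Lemma borel_open (A : set T) : open A -> measurable (A : set (borel T)).
Proof. exact: sub_sigma_algebra. Qed.

Lemma borel_closed (A : set T) : closed A -> measurable (A : set (borel T)).
Proof.
by move=> cA; rewrite -(setCK A); apply: measurableC; apply: borel_open; exact: closed_openC.
Qed.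

Lemma measurable_fun_borel d (S : measurableType d) (E : set S) (f : S -> T) :
  (measurable E -> forall U, open U -> measurable (E `&` f @^-1` U)) ->
  @measurable_fun _ _ S (borel T) E f.
Proof.
move=> mf mE; apply: (@measurability _ _ _ (borel T) _ _ (@open T)) => //.
by move=> _ [U oU <-]; exact: mf.
Qed.

End borel.

Lemma continuous_borel {S T : ptopologicalType} (E : set S) (f : S -> T) :
  measurable (E : set (borel S)) -> {within E, continuous f} ->
  @measurable_fun _ _ (borel S) (borel T) E f.
Proof.
move=> mE /continuousP cf; apply: measurable_fun_borel => _ U oU.
have /open_subspaceP[V oV VE] := cf U oU.
by rewrite setIC -VE; apply: measurableI => //; exact: borel_open.
Qed.

(** An enumeration of a countable basis, possibly with repetitions and with the
    empty set at the indices that the basis does not use. *)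
Lemma second_countable_enum {T : topologicalType} : @second_countable T ->
  exists B : (set T)^nat, (forall n, open (B n)) /\
    forall U x, open U -> U x -> exists n, B n x /\ B n `<=` U.
Proof.
move=> [B /countable_injP[f injf] [oB Bx]].
exists (fun n => [set x | exists b, [/\ B b, f b = n & b x]]); split=> [n|U x oU Ux].
  rewrite openE => x [b [Bb fb bx]]; rewrite /interior /=.
  have : nbhs x b by apply: open_nbhs_nbhs; split => //; exact: oB.
  by apply: filterS => y yb; exists b.
have [b [Bb bx] bU] := Bx x U (open_nbhs_nbhs (conj oU Ux)).
exists (f b); split; first by exists b.
move=> y [c [Bc fcb cy]]; apply: bU; rewrite -(injf c b)// inE//.
Qed.

(* The product is to be recognized as a pointed topological space, so that it has
   Borel sets. *)
HB.instance Definition _ (S T : ptopologicalType) := Pointed.on (S * T)%type.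

(** One countable basis B is enough: an open set of the product is the union over
    n of V n `*` B n, where V n is the largest open set with V n `*` B n inside. *)
Lemma measurable_fun_borel_pair {S T : ptopologicalType} d (U : measurableType d)
    (E : set U) (f : U -> S) (g : U -> T) :
  @second_countable T ->
  @measurable_fun _ _ U (borel S) E f -> @measurable_fun _ _ U (borel T) E g ->
  @measurable_fun _ _ U (borel (S * T)%type) E (fun u => (f u, g u)).
Proof.
move=> /second_countable_enum[B [oB Bsub]] mf mg.
apply: (@measurable_fun_borel (S * T)%type) => mE W oW.
pose V n := \bigcup_(A in [set A : set S | open A /\ A `*` B n `<=` W]) A.
have -> : E `&` (fun u => (f u, g u)) @^-1` W =
    \bigcup_n ((E `&` f @^-1` (V n)) `&` (E `&` g @^-1` (B n))).
  apply/seteqP; split => [u [Eu]|u [n _ [[Eu [A [oA AW] fuA]] [_ guB]]]] /=.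
    move=> Wu; have : nbhs (f u, g u) W by exact: open_nbhs_nbhs.
    move=> [[P Q] /= [nP nQ] PQ].
    have [n [Bn BQ]] : exists n, B n (g u) /\ B n `<=` interior Q.
      by apply: Bsub; [exact: open_interior|exact: nbhs_singleton (nbhs_interior nQ)].
    exists n => //; split; split => //.
    exists (interior P); last exact: nbhs_singleton (nbhs_interior nP).
    split; first exact: open_interior.
    by move=> [a b] /= [aP bB]; apply: PQ; split; apply: interior_subset => //; exact: BQ.
  by split => //; apply: AW.
apply: bigcupT_measurable => n; apply: measurableI.
  by apply: mf => //; apply: borel_open; apply: bigcup_open => A [].
by apply: mg => //; exact: borel_open.
Qed.

Lemma measurable_fun_real_borel {R : realType} d (S : measurableType d)
    (E : set S) (f : S -> R) :
  measurable_fun E f -> @measurable_fun _ _ S (borel R) E f.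
Proof.
move=> mf; apply: measurable_fun_borel => mE U oU.
by apply: mf => //; exact: open_measurable.
Qed.

Lemma probability_setIr {R : realType} d (T : measurableType d) (mu : probability T R)
    (A B : set T) :
  measurable A -> measurable B -> mu B = 1%E -> mu (A `&` B) = mu A.
Proof.
move=> mA mB muB; rewrite (measureDI mu mA mB) [X in (X + _)%E](_ : _ = 0%E) ?add0e//.
apply/eqP; rewrite eq_le measure_ge0 andbT.
apply: (@le_trans _ _ (mu (~` B))).
  by apply: le_measure; rewrite ?inE; [exact: measurableD|exact: measurableC|move=> x []].
by rewrite probability_setC// muB subee.
Qed.

Section borel_measures.
Context {R : realType} {X : pmetricType R}.
Hypothesis cX : compact [set: X].
Implicit Types mu : probability (borel X) R.
Local Open Scope ereal_scope.

(** The basic open sets that are null already cover U. *)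
Lemma locally_null_open mu (U : set X) :
  (forall x, U x -> exists2 V, open V /\ V x & mu V = 0) ->
  open U -> mu U = 0.
Proof.
move=> U0 oU.
have [B [oB Bsub]] := second_countable_enum (compact_second_countable cX).
pose C n := [set x | B n x /\ mu (B n) = 0].
have C0 n : measurable (C n : set (borel X)) /\ mu (C n) = 0.
  have [Bn0|Bn0] := pselect (mu (B n) = 0).
    have -> : C n = B n by apply/seteqP; split => [x []|x].
    by split => //; exact: borel_open.
  have -> : C n = set0 by apply/seteqP; split => [x []|x].
  by rewrite measure0.
apply/eqP; rewrite eq_le measure_ge0 andbT.
apply: (@le_trans _ _ (\sum_(0 <= n <oo) mu (C n))).
  apply: measure_sigma_subadditive.
  - by move=> n; have [] := C0 n.
  - exact: borel_open.
  move=> x Ux; have [V [oV Vx] V0] := U0 x Ux.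
  have [n [Bnx BV]] := Bsub V x oV Vx; exists n => //; split => //.
  apply/eqP; rewrite eq_le measure_ge0 andbT -V0.
  by apply: le_measure => //; rewrite inE; exact: borel_open.
by rewrite eseries0// => n _ _; have [] := C0 n.
Qed.

Lemma shrink_ndecr (U : set X) : {homo shrink U : n m / (n <= m)%N >-> (n <= m)%O}.
Proof.
move=> n m nm; apply/subsetPset => x; apply: contra_not => -[y nUy].
move=> xy; exists y => //; move: xy; apply: interiorS; apply: le_ball.
by rewrite lef_pV2 ?posrE// ler_nat.
Qed.

Lemma shrink_bigcup (U : set X) : open U -> \bigcup_n shrink U n = U.
Proof.
move=> oU; apply/seteqP; split => [x [n _]|x Ux]; first exact: shrink_subset.
have [[V N]/= [xV [n _ NN]] VN] := near_shrink oU Ux.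
by exists n => //; apply: (VN (x, n)); split => /=; [exact: nbhs_singleton xV|by apply: NN => /=].
Qed.

Lemma probability_unique_closed mu1 mu2 :
  (forall K : set X, closed K -> mu1 K = mu2 K) ->
  forall A : set (borel X), measurable A -> mu1 A = mu2 A.
Proof.
move=> mu12 A mA.
apply: (@g_sigma_algebra_measure_unique _ _ (borel X) (@closed X) _ (fun=> setT)).
- by move=> K cK; exact: borel_closed.
- by move=> _; exact: closedT.
- by rewrite bigcup_const.
- by move=> K L; exact: closedI.
- exact: mu12.
- by move=> _; rewrite (le_lt_trans (probability_le1 _ _))// ?ltry//; exact: measurableT.
- move: A mA; apply: smallest_sub; first exact: smallest_sigma_algebra.
  move=> U oU; rewrite -(setCK U) -setTD; apply: sigma_algebraCD.
  by apply: sub_sigma_algebra; exact: open_closedC.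
Qed.

(** Since F minus D is the increasing union of the closed sets F `&` shrink (~` D) n,
    the masses of its closed subsets determine the trace of each closed set. *)
Lemma probability_unique_closed_setD mu1 mu2 (F D : set X) :
  closed F -> closed D -> mu1 (F `\` D) = 1 -> mu2 (F `\` D) = 1 ->
  (forall K : set X, closed K -> K `<=` F `\` D -> mu1 K = mu2 K) ->
  forall A : set (borel X), measurable A -> mu1 A = mu2 A.
Proof.
move=> cF cD mu1Y mu2Y mu12; apply: probability_unique_closed => K cK.
have mF := borel_closed cF; have mD := borel_closed cD; have mK := borel_closed cK.
have mY : measurable (F `\` D : set (borel X)) by exact: measurableD.
have trace mu : mu (F `\` D) = 1 -> mu K = mu (K `&` (F `\` D)).
  by move=> muY; rewrite probability_setIr.
rewrite !trace//.
pose G n := K `&` F `&` shrink (~` D) n.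
have cG n : closed (G n).
  by apply: closedI; [exact: closedI|exact: closed_shrink].
have GE : \bigcup_n G n = K `&` (F `\` D).
  by rewrite -setI_bigcupr shrink_bigcup ?setDE ?setIA//; exact: closed_openC.
have cvgG mu : mu (G n) @[n --> \oo] --> mu (K `&` (F `\` D)).
  rewrite -GE; apply: nondecreasing_cvg_mu.
  - by move=> n; exact: borel_closed.
  - by rewrite GE; exact: measurableI.
  - move=> n m nm; apply/subsetPset; apply: setIS.
    exact/subsetPset/shrink_ndecr.
apply: (cvg_unique _ (cvgG mu1)) => //.
rewrite (_ : (fun n => mu1 (G n)) = (fun n => mu2 (G n))); first exact: cvgG.
apply/funext => n; apply: mu12 => // x [[Kx Fx]] /shrink_subset nDx.
by split.
Qed.

End borel_measures.

(** * The impulsive semiflow and its nonwandering set *)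

Lemma closed_nonwandering {R : realType} {X : topologicalType} (f : R -> X -> X) :
  closed (nonwandering f).
Proof.
rewrite -(setCK (nonwandering f)); apply: open_closedC; rewrite openE => x nOx.
apply: contrapT => nint; apply: nOx => U xU T T0.
have xU' := nbhs_interior xU.
apply: contrapT => nret; apply: nint; rewrite /interior /=.
apply: filterS xU' => y yU Oy; apply: nret.
have [t Tt [z [zU Uz]]] := Oy U yU T T0.
by exists t => //; exists z.
Qed.

Section impulsive_dynamics.
Context {R : realType} {X : pmetricType R}.
Variables (flow : R -> X -> X) (D : set X) (I : X -> X).
Hypothesis ids : impulsive_dynamical_system flow D I.

Notation tau1 := (tau1 flow D).
Notation phi := (impulsive_semiflow flow D I).
Notation Omega := (nonwandering phi).

Lemma flow0 x : flow 0 x = x.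
Proof. by case: ids => -[[f0 _] _] _ _ _ _; exact: f0. Qed.

Lemma flowD s t x : 0 <= s -> 0 <= t -> flow (t + s) x = flow t (flow s x).
Proof. by case: ids => -[[_ fD] _] _ _ _ _; exact: fD. Qed.

Lemma tau1_gt0 x : (0 < tau1 x)%E.
Proof. by case: ids. Qed.

Lemma closed_impulse_set : closed D.
Proof. by case: ids => _ cD _ _ _; apply: (compact_closed (@metric_hausdorff _ X)). Qed.

Lemma near_flow U t x : 0 <= t -> nbhs (flow t x) U ->
  \forall s \near t & y \near x, 0 <= s -> U (flow s y).
Proof.
case: ids => -[_ /subspace_continuousP cf] _ _ _ _ t0 Utx.
have : \forall p \near within (nonneg_time R X) (nbhs (t, x)), U (flow p.1 p.2).
  exact: cf.
by rewrite near_withinE; apply: filterS => -[].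
Qed.

Lemma flow_cvg {T : Type} (F : set_system T) {FF : Filter F} (u : T -> R) (v : T -> X)
    (t : R) (x : X) : 0 <= t -> (\forall i \near F, 0 <= u i) -> u @ F --> t -> v @ F --> x ->
  flow (u i) (v i) @[i --> F] --> flow t x.
Proof.
move=> t0 u0 ut vx U /(near_flow t0)[[P Q] /= [tP xQ] PQ].
rewrite /nbhs/=; near=> i; apply: (PQ (u i, v i)); last by near: i.
by split => /=; near: i; [exact: (ut P)|exact: (vx Q)].
Unshelve. all: by end_near. Qed.

Lemma not_hit_before s x : 0 < s -> (s%:E < tau1 x)%E -> ~ D (flow s x).
Proof.
move=> s0 /[swap] Ds; rewrite ltNge => /negP; apply.
by apply: ereal_inf_lbound; exists s.
Qed.

(** The infimum defining tau1 is attained, as D is closed and tau1 is positive. *)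
Lemma hit_tau1 t x : tau1 x = t%:E -> D (flow t x).
Proof.
move=> xt; have t0 : 0 < t by rewrite -lte_fin -xt tau1_gt0.
apply: contrapT => nDt.
have /(near_flow (ltW t0)) : nbhs (flow t x) (~` D).
  by apply: open_nbhs_nbhs; split => //; apply: closed_openC; exact: closed_impulse_set.
move=> [[P Q] /= [/nbhs_ballP[e /= e0 eP] xQ] PQ].
have xfin : tau1 x \is a fin_num by rewrite xt.
have [_ [s [s0 Ds] <-]] := lb_ereal_inf_adherent e0 xfin.
rewrite -/(tau1 x) xt -EFinD lte_fin => ste.
have ts : t <= s by rewrite -lee_fin -xt; apply: ereal_inf_lbound; exists s.
apply: (PQ (s, x) _ (ltW s0) Ds); split => /=; last exact: nbhs_singleton xQ.
by apply: eP; rewrite /ball/= ltr_distlC; apply/andP; split; lra.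
Qed.

Lemma lt_tau1P t x : 0 <= t ->
  (t%:E < tau1 x)%E <-> (forall s, 0 < s <= t -> ~ D (flow s x)).
Proof.
move=> t0; split=> [tx s /andP[s0 st]|nD].
  by apply: not_hit_before => //; apply: le_lt_trans tx; rewrite lee_fin.
rewrite lt_neqAle; apply/andP; split.
  apply/eqP => tx; have xt := esym tx.
  have t1 : 0 < t by rewrite -lte_fin tx tau1_gt0.
  by apply: (nD t); rewrite ?t1 ?lexx//; exact: hit_tau1.
apply: le_ereal_inf_tmp => _ [s [s0 Ds] <-]; rewrite lee_fin leNgt.
by apply/negP => st; apply: (nD s); rewrite ?s0 ?(ltW st).
Qed.

Lemma near_not_hit a b x : 0 <= a -> (forall s, a <= s <= b -> ~ D (flow s x)) ->
  \forall y \near x, forall s, a <= s <= b -> ~ D (flow s y).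
Proof.
move=> a0 nD; have /compact_near_coveringP := @segment_compact R a b.
move=> /(_ _ (nbhs x) (fun y s => 0 <= s -> ~ D (flow s y)) _) near_nD.
suff : \forall y \near x, `[a, b] `<=` (fun s => 0 <= s -> ~ D (flow s y)).
  apply: filterS => y nDy s sab; apply: nDy => //.
  by have /andP[sa _] := sab; exact: le_trans sa.
apply: near_nD => s.
rewrite /= in_itv/= => sab; apply: (@near_flow (~` D)).
  by have /andP[sa _] := sab; exact: le_trans sa.
apply: open_nbhs_nbhs; split; last exact: nD.
by apply: closed_openC; exact: closed_impulse_set.
Qed.

(** Lower semicontinuity of tau1 off D: a compact piece of trajectory that avoids
    the closed set D still avoids it after a perturbation. It fails on D, where
    nearby points may hit D at once. *)
Lemma near_lt_tau1 t x : ~ D x -> 0 <= t -> (t%:E < tau1 x)%E ->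
  \forall y \near x, ~ D y /\ (t%:E < tau1 y)%E.
Proof.
move=> nDx t0 /(lt_tau1P _ t0) nD.
have : forall s, 0 <= s <= t -> ~ D (flow s x).
  move=> s /andP[]; rewrite le_eqVlt => /predU1P[<- _|s0 st]; first by rewrite flow0.
  by apply: nD; rewrite s0 st.
move=> /(near_not_hit (lexx 0)); apply: filterS => y nDy; split.
  by rewrite -[y]flow0; apply: nDy; rewrite lexx.
by apply/lt_tau1P => // s /andP[s0 st]; apply: nDy; rewrite (ltW s0) st.
Qed.

Lemma tau1_flow s x : 0 <= s -> (s%:E < tau1 x)%E -> tau1 x = (tau1 (flow s x) + s%:E)%E.
Proof.
move=> s0 sx; apply/eqP; rewrite eq_le; apply/andP; split.
  rewrite -leeBlDr//; apply: le_ereal_inf_tmp => _ [t [t0 Dt] <-].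
  rewrite leeBlDr// -EFinD; apply: ereal_inf_lbound; exists (t + s) => //.
  by split; [exact: ltr_wpDr|rewrite flowD// ltW].
apply: le_ereal_inf_tmp => _ [t [t0 Dt] <-]; rewrite -leeBrDr// -EFinB.
have st : s < t.
  by rewrite -lte_fin; apply: lt_le_trans sx _; apply: ereal_inf_lbound; exists t.
apply: ereal_inf_lbound; exists (t - s) => //; split; first by rewrite subr_gt0.
by rewrite -flowD ?subrK// subr_ge0 ltW.
Qed.

Lemma impulse_pointS x n :
  impulse_point flow D I x n.+1 =
  impulse_point flow D I (I (flow (fine (tau1 x)) x)) n.
Proof. by elim: n => //= n <-. Qed.

(** The times are defined by recursion on the last impulse; peeling off the first
    one instead is what makes induction along a trajectory possible. *)
Lemma impulse_timeS x n :
  impulse_time flow D I x n.+1 =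
  (tau1 x + impulse_time flow D I (I (flow (fine (tau1 x)) x)) n)%E.
Proof.
elim: n => [|n ih]; first by rewrite /= add0e adde0.
by rewrite [LHS]/= -/(impulse_point flow D I x n.+1) impulse_pointS
  -/(impulse_time flow D I x n.+1) ih addeA.
Qed.

Lemma impulse_time_unbounded x t : exists n, (t%:E < impulse_time flow D I x n)%E.
Proof.
case: ids => _ _ _ _ /(_ x) life.
have : (t%:E < lifetime flow D I x)%E by rewrite life ltry.
by move=> /ereal_sup_gt[_ [n _ <-] tn]; exists n.
Qed.

Lemma impulsive_semiflow_flow t x : 0 <= t -> (t%:E < tau1 x)%E -> phi t x = flow t x.
Proof.
move=> t0 tx; rewrite /impulsive_semiflow (@impulsive_trajectoryE _ _ _ _ _ _ 0)/=.
  by rewrite subr0.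
by rewrite lee_fin t0 add0e.
Qed.

Lemma impulse_count_ex x t : 0 <= t -> exists n,
  (impulse_time flow D I x n <= t%:E < impulse_time flow D I x n.+1)%E.
Proof.
move=> t0; have ex := impulse_time_unbounded x t; case: (ex_minnP ex) => -[|n] tn min.
  by move: tn; rewrite /= lte_fin ltNge t0.
exists n; rewrite tn andbT leNgt; apply/negP => /min.
by rewrite ltnn.
Qed.

Lemma impulsive_semiflow_jump a t x : tau1 x = a%:E -> a <= t ->
  phi t x = phi (t - a) (I (flow a x)).
Proof.
move=> xa at_; have ta0 : 0 <= t - a by rewrite subr_ge0.
have [n /andP[nt tn]] := impulse_count_ex (I (flow a x)) ta0.
rewrite /impulsive_semiflow (@impulsive_trajectoryE _ _ _ _ _ _ n.+1); last first.
  rewrite [_ x n.+1]impulse_timeS [_ x n.+2]impulse_timeS xa/= addeC.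
  by rewrite [X in _ && (_ < X)%E]addeC -leeBrDr// -lteBlDr// -EFinB nt.
rewrite (@impulsive_trajectoryE _ _ _ _ _ _ n); last by rewrite nt.
rewrite impulse_pointS impulse_timeS xa /= fineD//; first by rewrite opprD addrA.
rewrite fin_numE; apply/andP; split; last by rewrite lt_eqF// (le_lt_trans nt)// ltry.
by rewrite gt_eqF// (lt_le_trans _ (impulse_time_ndecr _ _ _ _ (leq0n n)))//= ltNye.
Qed.

(** Induction on the number of impulses before time t, which is finite because
    trajectories have infinite lifetime. *)
Lemma impulsive_ind (P : R -> X -> Prop) :
  (forall t x, 0 <= t -> (t%:E < tau1 x)%E -> P t x) ->
  (forall a t x, tau1 x = a%:E -> a <= t -> P (t - a) (I (flow a x)) -> P t x) ->
  forall t x, 0 <= t -> P t x.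
Proof.
move=> Pflow Pjump t x t0; have [n] := impulse_time_unbounded x t.
elim: n t x t0 => [t x t0|n ih t x t0]; first by rewrite /= lte_fin ltNge t0.
have [tx _|] := ltP (t%:E)%E (tau1 x); first exact: Pflow.
case xa : (tau1 x) => [a| |] //.
  rewrite lee_fin => at_ tn; apply: (Pjump a) => //; apply: ih; first by rewrite subr_ge0.
  by move: tn; rewrite impulse_timeS xa/= addeC EFinB lteBlDr.
by have := tau1_gt0 x; rewrite xa.
Qed.

Lemma impulsive_semiflow0 x : phi 0 x = x.
Proof. by rewrite impulsive_semiflow_flow ?flow0// tau1_gt0. Qed.

Lemma impulsive_semiflowD s t x : 0 <= s -> 0 <= t -> phi (t + s) x = phi t (phi s x).
Proof.
move=> + t0; move: s x; apply: impulsive_ind => [s x s0 sx|a s x xa as_ ih].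
  rewrite (impulsive_semiflow_flow s0 sx); have := tau1_flow s0 sx.
  have [tsx|] := ltP (t + s)%:E (tau1 x).
    move=> xE; rewrite (impulsive_semiflow_flow (addr_ge0 t0 s0) tsx).
    rewrite impulsive_semiflow_flow ?flowD//.
    by move: tsx; rewrite EFinD xE lteD2rE.
  case xa : (tau1 x) => [a| |] //; last by have := tau1_gt0 x; rewrite xa.
  rewrite lee_fin => ats; case fa : (tau1 (flow s x)) => [b| |] // [] ab.
  rewrite (impulsive_semiflow_jump xa ats) (impulsive_semiflow_jump fa); last first.
    by move: ats; rewrite ab lerD2r.
  rewrite -flowD//; last by rewrite -lee_fin -fa ltW// tau1_gt0.
  by rewrite -ab; congr phi; lra.
rewrite (impulsive_semiflow_jump xa as_) -ih (impulsive_semiflow_jump xa).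
  by rewrite addrA.
by rewrite (le_trans as_)// lerDr.
Qed.

Lemma near_impulsive_semiflow U t x : ~ D x -> 0 <= t -> (t%:E < tau1 x)%E -> nbhs (flow t x) U ->
  \forall y \near x, U (phi t y).
Proof.
move=> nDx t0 tx /(near_flow t0)[[P Q] /= [tP xQ] PQ].
have := near_lt_tau1 nDx t0 tx; apply: filterS2 xQ => y Qy [_ ty].
rewrite impulsive_semiflow_flow//; apply: (PQ (t, y)) => //.
by split => //=; exact: nbhs_singleton tP.
Qed.

(** As phi_t is continuous at x, a return of points near x to themselves is carried
    by phi_t to a return of points near flow t x. *)
Lemma nonwandering_flow t x : Omega x -> ~ D x -> 0 <= t -> (t%:E < tau1 x)%E ->
  Omega (flow t x).
Proof.
move=> Ox nDx t0 tx U tU T T0.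
have [s Ts [y /= [yV Vy]]] := Ox _ (near_impulsive_semiflow nDx t0 tx tU) T T0.
exists s => //; exists (phi t y); split => //=.
have s0 : 0 <= s by rewrite (le_trans (ltW T0)).
by rewrite -impulsive_semiflowD// addrC impulsive_semiflowD.
Qed.

Lemma not_impulse_flow t x : ~ D x -> 0 <= t -> (t%:E < tau1 x)%E -> ~ D (flow t x).
Proof.
move=> nDx; rewrite le_eqVlt => /predU1P[<-|]; first by rewrite flow0.
exact: not_hit_before.
Qed.

(** The hitting point is the limit of the points flow s x of Omega for s < a. *)
Lemma nonwandering_hit a x : Omega x -> ~ D x -> tau1 x = a%:E ->
  (Omega `&` D) (flow a x).
Proof.
move=> Ox nDx xa; split; last exact: hit_tau1.
have a0 : 0 < a by rewrite -lte_fin -xa tau1_gt0.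
apply: contrapT => nO.
have /(near_flow (ltW a0)) : nbhs (flow a x) (~` Omega).
  by apply: open_nbhs_nbhs; split => //; apply: closed_openC; exact: (@closed_nonwandering _ _ phi).
move=> [[P Q] /= [/nbhs_ballP[e /= e0 eP] xQ] PQ].
(* A time s < a close enough to a, and nonnegative also when e is large. *)
pose s := Num.max 0 (a - e / 2).
have sa : s < a by rewrite /s gt_max a0/=; lra.
have s0 : 0 <= s by rewrite /s le_max lexx.
have ase : a - e / 2 <= s by rewrite /s le_max lexx orbT.
clearbody s; apply: (PQ (s, x)) => //=.
  split => /=; last exact: nbhs_singleton xQ.
  apply: eP; rewrite /ball/= ltr_distlC; apply/andP; split; lra.
by apply: nonwandering_flow => //; rewrite xa lte_fin.
Qed.

End impulsive_dynamics.

(** * Borel measurability of the impulsive semiflow *)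

Section impulsive_measurability.
Context {R : realType} {X : pmetricType R}.
Variables (flow : R -> X -> X) (D : set X) (I : X -> X).
Hypothesis cX : compact [set: X].
Hypothesis ids : impulsive_dynamical_system flow D I.

Notation tau1 := (tau1 flow D).
Notation phi := (impulsive_semiflow flow D I).
Notation impulse_time := (impulse_time flow D I).

Lemma continuous_borel_real {S : ptopologicalType} (f : S -> R) :
  continuous f -> @measurable_fun _ _ (borel S) R setT f.
Proof.
move=> /continuousP cf mS.
apply: (measurability _ (RGenOInfty.measurableE R)) => //.
move=> _ [_ [r ->] <-]; rewrite setTI; apply: borel_open; apply: cf.
exact: interval_open.
Qed.

(** The sets [r < tau1] are countable intersections of open sets: avoiding D during
    [1 / n.+1, r] is an open condition, and avoiding it during ]0, r] is the
    conjunction of these. On the whole of ]0, r] it need not be open. *)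
Lemma measurable_tau1 : @measurable_fun _ _ (borel X) (\bar R) setT tau1.
Proof.
move=> mX.
apply: (measurability _ (ErealGenOInfty.measurableE R)) => //.
move=> _ [_ [r ->] <-]; rewrite setTI.
have [r0|r0] := ltP r 0.
  rewrite (_ : _ @^-1` _ = setT); first exact: measurableT.
  apply/seteqP; split => // x _ /=; rewrite in_itv/= andbT.
  by apply: lt_trans (tau1_gt0 ids x); rewrite lte_fin.
rewrite (_ : _ @^-1` _ = \bigcap_n
    [set x | forall s, n.+1%:R^-1 <= s <= r -> ~ D (flow s x)]).
  apply: bigcapT_measurable => n; apply: borel_open; rewrite openE => x /=.
  by move=> nD; apply: (near_not_hit ids) nD; rewrite invr_ge0.
apply/seteqP; split => x /=; rewrite in_itv/= andbT.
  move=> /(lt_tau1P ids _ r0) nD n _ s /andP[ns sr]; apply: nD.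
  by rewrite sr andbT (lt_le_trans _ ns).
move=> nD; apply/(lt_tau1P ids _ r0) => s /andP[s0 sr].
have [n _ /(_ n (leqnn n)) ns] := near_infty_natSinv_lt (PosNum s0).
by apply: (nD n) => //; rewrite sr andbT ltW.
Qed.

Lemma closed_nonneg_time : closed (nonneg_time R X).
Proof.
apply: (@preimage_closed _ _ fst [set t : R | 0 <= t]); last exact: closed_ge.
by move=> p _; exact: cvg_fst.
Qed.

Lemma measurable_nonneg_time : measurable (nonneg_time R X : set (borel (R * X)%type)).
Proof. exact: (@borel_closed (R * X)%type _ closed_nonneg_time). Qed.

Lemma measurable_flow : @measurable_fun _ _ (borel (R * X)%type) (borel X)
  (nonneg_time R X) (fun p => flow p.1 p.2).
Proof.
apply: (@continuous_borel (R * X)%type X).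
  exact: measurable_nonneg_time.
by case: ids => -[].
Qed.

Lemma measurable_flow_comp d (S : measurableType d) (E : set S) (f : S -> R) (g : S -> X) :
  (forall u, E u -> 0 <= f u) ->
  measurable_fun E f -> @measurable_fun _ _ S (borel X) E g ->
  @measurable_fun _ _ S (borel X) E (fun u => flow (f u) (g u)).
Proof.
move=> f0 mf mg.
apply: (@measurable_comp _ _ _ S (borel (R * X)%type) (borel X) (nonneg_time R X)
  (fun p => flow p.1 p.2) E (fun u => (f u, g u))).
- exact: measurable_nonneg_time.
- by move=> _ [u Eu <-]; exact: f0.
- exact: measurable_flow.
- apply: (@measurable_fun_borel_pair R X).
  + exact: compact_second_countable.
  + exact: measurable_fun_real_borel.
  + exact: mg.
Qed.

Lemma measurable_impulse : @measurable_fun _ _ (borel X) (borel X) D I.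
Proof.
apply: continuous_borel; first exact: (borel_closed (closed_impulse_set ids)).
by case: ids.
Qed.

(** The state just after the first impulse. The value x when there is no impulse
    keeps it a Borel map on the whole space; impulse_point would apply I at x,
    possibly outside D, where I is arbitrary. *)
Definition first_impulse (x : X) : X :=
  if (tau1 x < +oo)%E then I (flow (fine (tau1 x)) x) else x.

Lemma first_impulseE x : (tau1 x < +oo)%E ->
  first_impulse x = I (flow (fine (tau1 x)) x).
Proof. by rewrite /first_impulse => ->. Qed.

Lemma measurable_first_impulse :
  @measurable_fun _ _ (borel X) (borel X) setT first_impulse.
Proof.
have mfin : measurable ([set x | (tau1 x < +oo)%E] : set (borel X)).
  rewrite -[X in measurable X]setTI.
  by apply: emeasurable_fun_infty_o => //; exact: measurable_tau1.
apply: (@measurable_fun_if _ _ (borel X) (borel X)) => //.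
- apply: (@measurable_fun_bool _ (borel X) _ _ true).
  by rewrite setTI.
- rewrite setTI (_ : _ @^-1` _ = [set x | (tau1 x < +oo)%E]); last by [].
  apply: (@measurable_comp _ _ _ (borel X) (borel X) (borel X) D I).
  + exact: (borel_closed (closed_impulse_set ids)).
  + move=> _ [x /= xfin <-]; apply: (hit_tau1 ids); rewrite fineK//.
    by rewrite ge0_fin_numE// ltW// (tau1_gt0 ids).
  + exact: measurable_impulse.
  + apply: measurable_flow_comp.
    * by move=> x _; rewrite fine_ge0// ltW// (tau1_gt0 ids).
    * apply: (@measurable_comp _ _ _ (borel X) (\bar R) R setT fine) => //.
      exact: measurable_funS measurable_tau1.
    * exact: (@measurable_id _ (borel X)).
Qed.

Lemma impulse_time_ge0 x n : (0 <= impulse_time x n)%E.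
Proof. exact: (impulse_time_ndecr flow D I x (leq0n n)). Qed.

Lemma impulse_time_first_impulse x n :
  impulse_time x n.+1 = (tau1 x + impulse_time (first_impulse x) n)%E.
Proof.
rewrite impulse_timeS; have [xfin|] := ltP (tau1 x) +oo%E.
  by rewrite first_impulseE.
rewrite leye_eq => /eqP ->; rewrite !addye//.
by rewrite gt_eqF// (lt_le_trans _ (impulse_time_ge0 _ _))// ltNye.
by rewrite gt_eqF// (lt_le_trans _ (impulse_time_ge0 _ _))// ltNye.
Qed.

Lemma impulse_point_first_impulse x n : (impulse_time x n < +oo)%E ->
  impulse_point flow D I x n = iter n first_impulse x.
Proof.
elim: n x => // n ih x; rewrite impulse_time_first_impulse impulse_pointS iterSr => xn.
have xfin : (tau1 x < +oo)%E.
  by apply: le_lt_trans xn; rewrite leeDl// impulse_time_ge0.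
rewrite -ih -?first_impulseE//.
by apply: le_lt_trans xn; rewrite leeDr// ltW// (tau1_gt0 ids).
Qed.

Lemma measurable_impulse_time n :
  @measurable_fun _ _ (borel X) (\bar R) setT (impulse_time ^~ n).
Proof.
elim: n => [|n ih]; first exact: measurable_cst.
rewrite (_ : _ ^~ _ = tau1 \+ (impulse_time ^~ n \o first_impulse))%E; last first.
  by apply/funext => x; exact: impulse_time_first_impulse.
apply: emeasurable_funD; first exact: measurable_tau1.
by apply: (@measurableT_comp _ _ _ (borel X) (borel X)) => //; exact: measurable_first_impulse.
Qed.

Lemma measurable_impulse_point n :
  @measurable_fun _ _ (borel X) (borel X) setT (iter n first_impulse).
Proof.
elim: n => [|n ih]; first exact: (@measurable_id _ (borel X)).
by apply: (@measurableT_comp _ _ _ (borel X) (borel X)) => //; exact: measurable_first_impulse.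
Qed.

(** Between the n-th and the next impulse, phi is the continuous flow applied to
    Borel functions of (t, x), and these countably many pieces cover all times. *)
Lemma impulsive_semiflow_measurable : borel_measurable_semiflow phi.
Proof.
pose E n : set (borel (R * X)%type) :=
  [set p | (impulse_time p.2 n <= p.1%:E < impulse_time p.2 n.+1)%E].
have mfst : @measurable_fun _ _ (borel (R * X)%type) R setT fst.
  by apply: (@continuous_borel_real (R * X)%type) => p; exact: cvg_fst.
have msnd : @measurable_fun _ _ (borel (R * X)%type) (borel X) setT snd.
  apply: (@continuous_borel (R * X)%type X); first exact: measurableT.
  by apply: continuous_subspaceT => p; exact: cvg_snd.
have mtime n : @measurable_fun _ _ (borel (R * X)%type) (\bar R) setT
    (fun p => impulse_time p.2 n).
  by have := measurableT_comp (measurable_impulse_time n) msnd; apply.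
have mEfst : @measurable_fun _ _ (borel (R * X)%type) (\bar R) setT (fun p => p.1%:E).
  exact/measurable_EFinP.
have mE n : measurable (E n).
  rewrite (_ : E n = [set p | (impulse_time p.2 n <= p.1%:E)%E] `&`
                     [set p | (p.1%:E < impulse_time p.2 n.+1)%E]); last first.
    by apply/seteqP; split => p /andP.
  apply: measurableI; rewrite -[X in measurable X]setTI.
    exact: measurable_fun_lee.
  exact: measurable_fun_lte.
rewrite /borel_measurable_semiflow.
rewrite (_ : nonneg_time R X = \bigcup_n E n); last first.
  apply/seteqP; split => [[t x]/= t0|[t x] [n _ /andP[/= nt _]]].
    by have [n nt] := impulse_count_ex ids x t0; exists n.
  by rewrite /nonneg_time/= -lee_fin (le_trans (impulse_time_ge0 _ _) nt).
apply/measurable_fun_bigcup => // n.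
apply: (@eq_measurable_fun _ _ (borel (R * X)%type) (borel X) _
  (fun p => flow (p.1 - fine (impulse_time p.2 n)) (iter n first_impulse p.2))).
  move=> [t x]; rewrite inE => /= tn; rewrite [RHS](@impulsive_trajectoryE _ _ _ _ _ _ n)//.
  rewrite impulse_point_first_impulse//.
  by have /andP[nt _] := tn; rewrite (le_lt_trans nt)// ltry.
apply: measurable_flow_comp.
- move=> [t x] /andP[/= nt _]; rewrite subr_ge0 -lee_fin fineK//.
  by rewrite ge0_fin_numE ?impulse_time_ge0// (le_lt_trans nt)// ltry.
- apply: measurable_funB.
    exact: measurable_funS mfst.
  apply: (@measurable_comp _ _ _ _ _ R setT fine) => //.
  exact: measurable_funS (mtime n).
- apply: (@measurable_comp _ _ _ (borel (R * X)%type) (borel X) (borel X) setT) => //.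
    exact: measurable_impulse_point.
  exact: measurable_funS msnd.
Qed.

End impulsive_measurability.

(** * Support of invariant probabilities *)

Section recurrence.
Context {R : realType} {X : pmetricType R}.
Variable f : R -> X -> X.
Local Open Scope ereal_scope.

Lemma measurable_time_map t : borel_measurable_semiflow f -> (0 <= t)%R ->
  @measurable_fun _ _ (borel X) (borel X) setT (f t).
Proof.
move=> mf t0; apply: (@measurable_comp _ _ _ (borel X) (borel (R * X)%type) (borel X)
  (nonneg_time R X) (fun p => f p.1 p.2) setT (fun x => (t, x))) => //.
- exact: measurable_nonneg_time.
- by move=> _ [x _ <-].
- apply: (@continuous_borel X (R * X)%type); first exact: measurableT.
  apply: continuous_subspaceT => x V [[P Q] /= [tP xQ] PQ].
  apply: filterS xQ => y Qy; apply: PQ; split => //=.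
  exact: nbhs_singleton tP.
Qed.

(** Poincare recurrence: the preimages of U at the times k * T are pairwise
    disjoint and have the same mass. *)
Lemma wandering_null (mu : probability (borel X) R) (U : set X) T :
  (forall s t x, (0 <= s)%R -> (0 <= t)%R -> f (t + s) x = f t (f s x)) ->
  invariant_probability f mu -> measurable (U : set (borel X)) -> (0 < T)%R ->
  (forall t, (T <= t)%R -> f t @^-1` U `&` U = set0) -> mu U = 0.
Proof.
move=> fD [mf inv] mU T0 wU.
have kT0 (k : nat) : (0 <= T *+ k)%R by rewrite mulrn_wge0// ltW.
pose A (k : nat) : set (borel X) := f (T *+ k) @^-1` U.
have mA k : measurable (A k).
  rewrite /A -[X in measurable X]setTI.
  by apply: (measurable_time_map mf (kT0 k)) => //; exact: measurableT.
have tA : trivIset setT A.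
  have disj k l : (k < l)%N -> A k `&` A l = set0.
    move=> kl; apply/seteqP; split => // x [Akx Alx].
    have kl0 : (T <= T *+ (l - k))%R.
      by rewrite -{1}[T]mulr1n ler_wpMn2l// ?ltW// subn_gt0.
    have : (f (T *+ (l - k)) @^-1` U `&` U) (f (T *+ k) x).
      by split; last exact: Akx; rewrite /= -fD// -mulrnDr subnK// ltnW.
    by rewrite wU.
  apply/trivIsetP => k l _ _; rewrite neq_ltn => /orP[/disj//|lk].
  by rewrite setIC disj.
have AU k : mu (A k) = mu U by exact: inv.
apply/eqP; rewrite eq_le measure_ge0 andbT leNgt; apply/negP => U0.
have Ufin : mu U \is a fin_num by exact: fin_num_measure.
have c0 : (0 < fine (mu U))%R by rewrite fine_gt0// U0 ltey_eq Ufin.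
(* n.+1 disjoint sets of mass mu U would have total mass larger than 1. *)
pose n := Num.truncn (fine (mu U))^-1.
have : mu (\big[setU/set0]_(i < n.+1) A i) <= 1.
  by apply: probability_le1; exact: bigsetU_measurable.
rewrite measure_bigsetU// (eq_bigr (fun=> mu U)) => [|i _]; last exact: AU.
rewrite -(fineK Ufin) sumEFin sumr_const card_ord lee_fin leNgt => /negP; apply.
by rewrite -mulr_natl -ltr_pdivrMr// mul1r truncnS_gt.
Qed.

End recurrence.

Section invariant_support.
Context {R : realType} {X : pmetricType R}.
Variables (flow : R -> X -> X) (D : set X) (I : X -> X).
Hypothesis cX : compact [set: X].
Hypothesis ids : impulsive_dynamical_system flow D I.
Notation tau1 := (tau1 flow D).
Notation phi := (impulsive_semiflow flow D I).
Notation Omega := (nonwandering phi).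
Hypothesis invI : I @` (Omega `&` D) `<=` Omega `\` D.

Lemma nonwandering_setD_invariant t x : 0 <= t -> (Omega `\` D) x -> (Omega `\` D) (phi t x).
Proof.
move=> t0; move: t x t0; apply: (impulsive_ind ids) => [t x t0 tx [Ox nDx]|].
  rewrite impulsive_semiflow_flow//.
  by split; [exact: nonwandering_flow|exact: (not_impulse_flow ids)].
move=> a t x xa at_ ih [Ox nDx]; rewrite (impulsive_semiflow_jump ids xa at_); apply: ih.
by apply: invI; exists (flow a x) => //; exact: nonwandering_hit.
Qed.

Variable mu : probability (borel X) R.
Hypothesis muP : invariant_probability phi mu.
Local Open Scope ereal_scope.

Lemma wandering_nbhs_null x : ~ Omega x -> exists2 U, open U /\ U x & mu U = 0.
Proof.
move=> /existsNP[V] /not_implyP[xV] /existsNP[T] /not_implyP[T0] nret.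
exists (interior V); first by split; [exact: open_interior|exact: nbhs_singleton (nbhs_interior xV)].
apply: (@wandering_null _ _ phi mu _ T) => //.
- by move=> s t y s0 t0; exact: (impulsive_semiflowD ids).
- by apply: borel_open; exact: open_interior.
move=> t Tt; apply: contrapT => /eqP/set0P[y [Vty Vy]]; apply: nret.
by exists t => //; exists y; split; [exact: interior_subset Vty|exact: interior_subset Vy].
Qed.

Lemma measure_support_nonwandering : measure_support mu `<=` Omega.
Proof.
move=> x mux; apply: contrapT => /wandering_nbhs_null[U [oU Ux] U0].
have := mux U (open_nbhs_nbhs (conj oU Ux)) (borel_open oU).
by rewrite U0 ltxx.
Qed.

Lemma measure_nonwandering : mu Omega = 1.
Proof.
have cO := @closed_nonwandering _ _ phi; have mO := borel_closed cO.
have : mu (~` Omega) = 0.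
  by apply: locally_null_open => //; [exact: wandering_nbhs_null|exact: closed_openC].
rewrite probability_setC// => /eqP; rewrite sube_eq//.
by rewrite add0e => /eqP.
Qed.

(** C n collects the points of Omega in D with tau1 > 1 / n.+1. At time 1 / n.+1
    neither Y nor C n is sent into D, so mu D <= mu D - mu (C n); and the sets C n
    exhaust Omega `&` D because tau1 > 0. *)
Lemma measure_impulse_set : mu D = 0.
Proof.
have mO := borel_closed (@closed_nonwandering _ _ phi).
have mD := borel_closed (closed_impulse_set ids).
have mOD := measurableI _ _ mO mD.
have onO (A : set (borel X)) : measurable A -> mu A = mu (A `&` Omega).
  by move=> mA; rewrite probability_setIr//; exact: measure_nonwandering.
pose C (n : nat) : set (borel X) := Omega `&` D `&` [set x | n.+1%:R^-1%:E < tau1 x].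
have mC n : measurable (C n).
  by apply: emeasurable_fun_o_infty => //; apply: measurable_funS (measurable_tau1 ids).
have C0 n : mu (C n) = 0.
  have n0 : (0 <= n.+1%:R^-1 :> R)%R by rewrite invr_ge0.
  have mpre : measurable (phi n.+1%:R^-1 @^-1` D : set (borel X)).
    rewrite -[X in measurable X]setTI.
    by apply: (measurable_time_map (proj1 muP) n0) => //; exact: measurableT.
  have : mu D <= mu ((Omega `&` D) `\` C n).
    rewrite -(proj2 muP D n.+1%:R^-1%R)// onO//; apply: le_measure; rewrite ?inE.
    - exact: measurableI.
    - exact: measurableD.
    move=> x [/= Dx Ox].
    have Dx' : D x.
      by apply: contrapT => nDx; have [] := nonwandering_setD_invariant n0 (conj Ox nDx).
    split=> // -[_ /= nx]; move: Dx; rewrite impulsive_semiflow_flow//.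
    by apply: not_hit_before nx; rewrite invr_gt0.
  rewrite measureD//; last by rewrite (le_lt_trans (probability_le1 _ _))// ltry.
  rewrite onO// setIC (setIidr (_ : C n `<=` _)); last by move=> x [].
  have fC : mu (C n) \is a fin_num by exact: fin_num_measure.
  have fD : mu (Omega `&` D) \is a fin_num by exact: fin_num_measure.
  have cancel (c d : \bar R) : c \is a fin_num -> d \is a fin_num -> 0 <= c ->
      d <= d - c -> c = 0.
    move: c d => [c| |] [d| |]// _ _.
    by rewrite -EFinB !lee_fin => c0 cd; congr EFin; lra.
  exact: cancel fC fD (measure_ge0 mu (C n)).
rewrite onO// setIC; apply/eqP; rewrite eq_le measure_ge0 andbT.
apply: (@le_trans _ _ (\sum_(0 <= n <oo) mu (C n))); last by rewrite eseries0.
apply: measure_sigma_subadditive => // x Ox.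
suff [n nx] : exists n, n.+1%:R^-1%:E < tau1 x by exists n.
have := tau1_gt0 ids x; case xa : (tau1 x) => [a| |] //; last first.
  by exists 0%N; rewrite ltry.
rewrite lte_fin => a0; have [n _ /(_ n (leqnn n))] := near_infty_natSinv_lt (PosNum a0).
by exists n.
Qed.

End invariant_support.

(** * Continuous functions and hitting times *)

Section capped.
Context {R : realType}.
Local Open Scope ereal_scope.

(** Truncation at d makes a time in [0, +oo] real-valued without losing
    continuity at +oo. *)
Definition cap (d : R) (a : \bar R) : R := fine (mine a d%:E).

Lemma cap_fin (d a : R) : cap d a%:E = Num.min a d.
Proof. by rewrite /cap -EFin_min. Qed.

Lemma cap_ge (d : R) a : d%:E <= a -> cap d a = d.
Proof. by move=> da; rewrite /cap min_r. Qed.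

Lemma cap_ge0 (d : R) a : (0 <= d)%R -> 0 <= a -> (0 <= cap d a)%R.
Proof.
by move=> d0 a0; apply: fine_ge0; rewrite le_min a0 lee_fin.
Qed.

Lemma cap_gt0 (d : R) a : (0 < d)%R -> 0 < a -> (0 < cap d a)%R.
Proof.
move=> d0; case: a => [a a0|_|//]; last by rewrite cap_ge//; exact: leey.
by rewrite cap_fin lt_min d0 andbT -lte_fin.
Qed.

Lemma cvg_cap {T : Type} (F : set_system T) {FF : Filter F} (h : T -> \bar R) l (d : R) :
  l != -oo -> h @ F --> l -> cap d (h x) @[x --> F] --> cap d l.
Proof.
move=> lNy hl; apply: fine_cvg.
have -> : (cap d l)%:E = mine l d%:E.
  rewrite /cap fineK//; case: l lNy {hl} => [l _|_|//]; first by rewrite -EFin_min.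
  by rewrite min_r//; exact: leey.
apply: (@continuous2_cvg _ (\bar R) (\bar R) (\bar R) F _ h (cst d%:E)
  (fun x y => mine x y) l d%:E) => //; last exact: cvg_cst.
exact: (@min_continuous _ (\bar R) (l, d%:E)).
Qed.

End capped.

Section distance_to_closed.
Context {R : realType} {X : pmetricType R}.

(** The distance to K, capped at 1 so that it is also defined for K empty. *)
Lemma closed_zero_set (K : set X) : closed K ->
  exists d : X -> R, [/\ continuous d, forall x, 0 <= d x & forall x, d x = 0 <-> K x].
Proof.
move=> cK; exists (cap 1 \o @edist_inf R X K); split=> [x|x|x].
- apply: cvg_cap; first by rewrite edist_inf_neqNy.
  exact: edist_inf_continuous.
- by rewrite /= cap_ge0// edist_inf_ge0.
split=> [dx|Kx]; last by rewrite /= edist_inf0// cap_fin min_l.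
apply: contrapT => nKx; suff : 0 < cap 1 (@edist_inf R X K x) by rewrite -dx ltxx.
apply: cap_gt0 => //.
have : nbhs x (~` K) by apply: open_nbhs_nbhs; split => //; exact: closed_openC.
move=> /nbhs_ballP[e /= e0 xeK]; apply: (@lt_le_trans _ _ e%:E); first by rewrite lte_fin.
apply: le_ereal_inf_tmp => _ [y Ky <-]; rewrite leNgt; apply/negP => /edist_lt_ball.
by move=> /xeK; apply.
Qed.

End distance_to_closed.

Lemma within_continuous_comp {S T U : topologicalType} (A : set S) (B : set T)
    (u : S -> T) (f : T -> U) :
  {within A, continuous u} -> {within B, continuous f} -> (forall x, A x -> B (u x)) ->
  {within A, continuous (f \o u)}.
Proof.
move=> /subspace_continuousP cu /subspace_continuousP cf AB.
apply/subspace_continuousP => x Ax V /(cf _ (AB x Ax)); rewrite /nbhs/= => uV.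
have := cu x Ax _ uV; rewrite /nbhs/= /within/=.
by apply: filterS => y uy Ay; exact: uy Ay (AB y Ay).
Qed.

(** Off D the positive function tau1 is lower semicontinuous, hence bounded below by
    a positive constant on each compact set. *)
Lemma compact_lt_tau1 {R : realType} {X : pmetricType R} flow D I (K : set X) :
  impulsive_dynamical_system flow D I -> compact K -> K `<=` ~` D ->
  exists2 d : R, 0 < d & forall x, K x -> (d%:E < tau1 flow D x)%E.
Proof.
move=> ids /compact_near_coveringP cK KD.
have := cK R (0^'+) (fun d x => (d%:E < tau1 flow D x)%E) _.
have near_tau x : K x -> \forall y \near x & d \near (0 : R)^'+, (d%:E < tau1 flow D y)%E.
  move=> Kx; have [t t0 tx] : exists2 t : R, 0 < t & (t%:E < tau1 flow D x)%E.
    have := tau1_gt0 ids x; case: (tau1 flow D x) => [a| |]//.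
      by rewrite lte_fin => a0; exists (a / 2); rewrite ?divr_gt0// lte_fin; lra.
    by exists 1 => //; rewrite ltry.
  exists ([set y | ~ D y /\ (t%:E < tau1 flow D y)%E], [set d | d <= t]) => /=.
    split; first by apply: (near_lt_tau1 ids) tx; [exact: KD|exact: ltW].
    exact: nbhs_right_le.
  by move=> [y d] /= [[_ ty] dt]; apply: le_lt_trans ty; rewrite lee_fin.
move=> /(_ _ near_tau) near_d.
near (0 : R)^'+ => d; exists d => //.
have Kd : K `<=` (fun x => (d%:E < tau1 flow D x)%E) by near: d.
by move=> x /Kd.
Unshelve. all: by end_near. Qed.

(** A cluster point of any orbit, sampled at integer times, is nonwandering. *)
Lemma nonwandering_nonempty {R : realType} {X : pmetricType R} (f : R -> X -> X) :
  compact [set: X] ->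
  (forall s t x, 0 <= s -> 0 <= t -> f (t + s) x = f t (f s x)) ->
  exists x, nonwandering f x.
Proof.
move=> cX fD; pose u (n : nat) := f n%:R point.
have [p [_ clp]] := cX (u @ \oo) _ filterT.
exists p => U pU T T0; pose N := (Num.truncn T).+1.
have [_ [[k _ <-]]] : [set u k | k in setT] `&` U !=set0.
  by apply: clp => //; exists 0%N => // n _; exists n.
move=> Uk; have [_ [[l /= kl <-] Ul]] : [set u l | l in [set l | (k + N <= l)%N]] `&` U !=set0.
  by apply: clp => //; exists (k + N)%N => // n kn; exists n.
have kl' : (k <= l)%N by rewrite (leq_trans _ kl)// leq_addr.
exists (l - k)%:R; last first.
  exists (u k); split => //; rewrite /= /u -fD// -natrD subnK//.
apply/ltW; apply: (@lt_le_trans _ _ N%:R); first exact: truncnS_gt.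
by rewrite ler_nat leq_subRL.
Qed.

(** * Functions on the glued nonwandering set *)

Lemma closed_within_preimage {S T : topologicalType} (A : set S) (B : set T) (u : S -> T) :
  closed A -> {within A, continuous u} -> closed B -> closed (A `&` u @^-1` B).
Proof.
move=> cA /continuous_closedP cu cB.
have /closed_subspaceP[V cV VA] := cu B cB.
by rewrite setIC -VA; exact: closedI.
Qed.

Section gluing.
Context {R : realType} {X : pmetricType R}.
Variables (flow : R -> X -> X) (D : set X) (I : X -> X).
Hypothesis cX : compact [set: X].
Hypothesis ids : impulsive_dynamical_system flow D I.
Notation tau1 := (tau1 flow D).
Notation tauD := (tauD flow D).
Notation phi := (impulsive_semiflow flow D I).
Notation Omega := (nonwandering phi).
Hypothesis tauc : {within Omega, continuous tauD}.
Hypothesis invI : I @` (Omega `&` D) `<=` Omega `\` D.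

Let cO : closed Omega := @closed_nonwandering _ _ phi.

(** The projection to the glued space, seen in the set of representatives Y. *)
Definition reset (x : X) : X := if x \in D then I x else x.

Lemma reset_in x : D x -> reset x = I x.
Proof. by move=> Dx; rewrite /reset mem_set. Qed.

Lemma reset_out x : ~ D x -> reset x = x.
Proof. by move=> Dx; rewrite /reset memNset. Qed.

Lemma tauD_in x : D x -> tauD x = 0%E.
Proof. by move=> Dx; rewrite /Defs.tauD mem_set. Qed.

Lemma tauD_out x : ~ D x -> tauD x = tau1 x.
Proof. by move=> Dx; rewrite /Defs.tauD memNset. Qed.

Lemma tauD_ge0 x : (0 <= tauD x)%E.
Proof.
have [Dx|Dx] := pselect (D x); first by rewrite tauD_in.
by rewrite tauD_out// ltW// (tau1_gt0 ids).
Qed.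

Lemma reset_nonwandering x : Omega x -> (Omega `\` D) (reset x).
Proof.
move=> Ox; have [Dx|Dx] := pselect (D x); last by rewrite reset_out.
by rewrite reset_in//; apply: invI; exists x.
Qed.

(** The waiting time is tauD and not tau1: the map is then the identity on D, and
    it inherits the continuity of tauD near D. *)
Definition next_hit (x : X) : X := flow (fine (tauD x)) x.

Lemma next_hit_in x : D x -> next_hit x = x.
Proof. by move=> Dx; rewrite /next_hit tauD_in// (flow0 ids). Qed.

Lemma next_hitP (t : R) x : Omega x -> (tauD x <= t%:E)%E -> (Omega `&` D) (next_hit x).
Proof.
move=> Ox xt; have [Dx|Dx] := pselect (D x); first by rewrite next_hit_in.
move: xt; rewrite /next_hit tauD_out//; case xa : (tau1 x) => [a| |] //= _.
  by apply: nonwandering_hit.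
by have := tau1_gt0 ids x; rewrite xa.
Qed.

Lemma closed_tauD_le t : closed (Omega `&` [set x | (tauD x <= t%:E)%E]).
Proof.
exact: (@closed_within_preimage _ _ Omega [set y | (y <= t%:E)%E] tauD cO tauc
  (@closed_ereal_ge_ereal _ _)).
Qed.

Lemma closed_tauD_ge t : closed (Omega `&` [set x | (t%:E <= tauD x)%E]).
Proof.
exact: (@closed_within_preimage _ _ Omega [set y | (t%:E <= y)%E] tauD cO tauc
  (@closed_ereal_le_ereal _ _)).
Qed.

Lemma continuous_fine_tauD t :
  {within Omega `&` [set x | (tauD x <= t%:E)%E], continuous (fine \o tauD)}.
Proof.
have : {within Omega `&` [set x | (tauD x <= t%:E)%E], continuous tauD}.
  by apply: continuous_subspaceW tauc => x [].
move=> /subspace_continuousP ct; apply/subspace_continuousP => x Ax.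
apply: fine_cvg; rewrite fineK; first exact: ct.
by rewrite ge0_fin_numE ?tauD_ge0// (le_lt_trans (proj2 Ax))// ltry.
Qed.

Lemma continuous_next_hit t :
  {within Omega `&` [set x | (tauD x <= t%:E)%E], continuous next_hit}.
Proof.
apply/subspace_continuousP => x Ax; apply: (flow_cvg ids).
- by rewrite fine_ge0// tauD_ge0.
- by apply: nearW => y; rewrite fine_ge0// tauD_ge0.
- by have /subspace_continuousP := continuous_fine_tauD (t := t); exact.
- by apply: cvg_within.
Qed.

Lemma continuous_reset_next_hit t :
  {within Omega `&` [set x | (tauD x <= t%:E)%E], continuous (I \o next_hit)}.
Proof.
have cI : {within D, continuous I} by case: ids.
apply: (within_continuous_comp (continuous_next_hit (t := t)) cI) => x [Ox xt].
by have [] := next_hitP Ox xt.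
Qed.

Lemma compact_reset_impulse : compact (I @` (Omega `&` D)).
Proof.
have [_ cD cI _ _] := ids; apply: continuous_compact.
  by apply: continuous_subspaceW cI => x [].
by rewrite setIC; exact: compact_closedI.
Qed.

Lemma impulsive_semiflow_reset_before t x : Omega x -> 0 <= t -> (t%:E < tauD x)%E ->
  phi t (reset x) = flow t x.
Proof.
move=> Ox t0; have [Dx|Dx] := pselect (D x).
  by rewrite tauD_in// lte_fin ltNge t0.
by rewrite tauD_out// reset_out// => tx; rewrite impulsive_semiflow_flow.
Qed.

(** The smallness of t rules out a second impulse, so a single formula describes
    phi t \o reset on the whole closed set [tauD <= t], including D. *)
Lemma impulsive_semiflow_reset_after t x : Omega x -> (tauD x <= t%:E)%E ->
  (forall y, (I @` (Omega `&` D)) y -> (t%:E < tau1 y)%E) ->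
  phi t (reset x) = flow (t - fine (tauD x)) (I (next_hit x)).
Proof.
move=> Ox xt small; have small' s : s <= t -> (s%:E < tau1 (I (next_hit x)))%E.
  move=> st; apply: (@le_lt_trans _ _ t%:E); first by rewrite lee_fin.
  by apply: small; exists (next_hit x) => //; exact: next_hitP xt.
have [Dx|Dx] := pselect (D x).
  have := small' t (lexx _); move: xt.
  rewrite tauD_in// reset_in// next_hit_in// subr0 lee_fin => t0 tx.
  exact: impulsive_semiflow_flow.
move: xt small'; rewrite reset_out// /next_hit tauD_out//.
case xa : (tau1 x) => [a| |] //=; last by have := tau1_gt0 ids x; rewrite xa.
rewrite lee_fin => at_ small'.
rewrite (impulsive_semiflow_jump ids xa at_) impulsive_semiflow_flow//.
  by rewrite subr_ge0.
by apply: small'; rewrite gerBl -lee_fin -xa ltW// (tau1_gt0 ids).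
Qed.

(** The continuous functions on the space obtained from Omega by identifying x
    with I x for x in D. Values outside Omega are irrelevant. *)
Definition glued (f : X -> R) : Prop :=
  {within Omega, continuous f} /\ forall x, Omega x -> D x -> f (I x) = f x.

Lemma glued_reset f x : glued f -> Omega x -> f (reset x) = f x.
Proof.
move=> [_ fI] Ox; have [Dx|Dx] := pselect (D x); last by rewrite reset_out.
by rewrite reset_in// fI.
Qed.

Lemma eq_glued f g : (forall x, Omega x -> f x = g x) -> glued f -> glued g.
Proof.
move=> fg [cf fI]; split; last first.
  by move=> x Ox Dx; rewrite -!fg ?fI//; have [] : (Omega `\` D) (I x) by apply: invI; exists x.
by apply: subspace_eq_continuous cf => x; rewrite inE; exact: fg.
Qed.

(** Omega is the union of the closed sets [tauD <= t] and [t <= tauD]. On the first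
    one phi t \o reset is continuous. On the second one f \o phi t \o reset is
    f \o flow t: this is clear if t < tauD x, and for t = tauD x it is the equality
    f (I y) = f y at y = flow t x. *)
(** By the semigroup law t may be replaced by t / n, short enough to leave no room
    for two impulses: tau1 is bounded below on the compact image of I. *)
Lemma glued_impulsive_semiflow_small t f : 0 <= t ->
  (forall y, (I @` (Omega `&` D)) y -> (t%:E < tau1 y)%E) ->
  glued f -> glued (f \o phi t \o reset).
Proof.
move=> t0 small gf; have [cf fI] := gf; split; last first.
  move=> x Ox Dx /=; rewrite (reset_in Dx).
  by have [_ /reset_out->] : (Omega `\` D) (I x) by apply: invI; exists x.
have -> : Omega = (Omega `&` [set x | (tauD x <= t%:E)%E]) `|`
                  (Omega `&` [set x | (t%:E <= tauD x)%E]).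
  apply/seteqP; split => [x Ox|x [[]|[]]//].
  by have [xt|/ltW tx] := leP (tauD x) t%:E; [left|right].
have cA := closed_tauD_le (t := t).
apply: withinU_continuous; [exact: closed_tauD_le|exact: closed_tauD_ge| |].
- have YA x : (Omega `&` [set x | (tauD x <= t%:E)%E]) x -> (Omega `\` D) (phi t (reset x)).
    by move=> [Ox _]; apply: (nonwandering_setD_invariant ids invI t0); exact: reset_nonwandering.
  have cg : {within Omega `&` [set x | (tauD x <= t%:E)%E],
      continuous (fun x => flow (t - fine (tauD x)) (I (next_hit x)))}.
    apply/subspace_continuousP => x [Ox xt]; apply: (flow_cvg ids).
    + rewrite subr_ge0 -lee_fin fineK//.
      by rewrite ge0_fin_numE ?tauD_ge0// (le_lt_trans xt)// ltry.
    + rewrite near_withinE; apply: nearW => y [Oy yt].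
      rewrite subr_ge0 -lee_fin fineK//.
      by rewrite ge0_fin_numE ?tauD_ge0// (le_lt_trans yt)// ltry.
    + apply: cvgB; first exact: cvg_cst.
      by have /subspace_continuousP := continuous_fine_tauD (t := t); apply.
    + by have /subspace_continuousP := continuous_reset_next_hit (t := t); apply.
  apply: subspace_eq_continuous (within_continuous_comp cg cf _).
    by move=> x; rewrite inE => -[Ox xt]; rewrite /from_subspace/= impulsive_semiflow_reset_after.
  by move=> x Ax; have [Ox xt] := Ax; rewrite -impulsive_semiflow_reset_after//; have [] := YA x Ax.
- have gE x : Omega x -> (t%:E <= tauD x)%E ->
      Omega (flow t x) /\ f (flow t x) = f (phi t (reset x)).
    move=> Ox; rewrite le_eqVlt => /predU1P[tx|tx].
      have xt : (tauD x <= t%:E)%E by rewrite -tx.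
      have hx : next_hit x = flow t x by rewrite /next_hit -tx.
      have := next_hitP Ox xt; rewrite hx => -[Oh Dh]; split => //.
      by rewrite (impulsive_semiflow_reset_after Ox xt small) -tx/= subrr (flow0 ids) hx fI.
    rewrite impulsive_semiflow_reset_before//; split => //.
    have nDx : ~ D x by move=> Dx; move: tx; rewrite tauD_in// lte_fin ltNge t0.
    by apply: nonwandering_flow => //; rewrite -tauD_out.
  have ct : {within Omega `&` [set x | (t%:E <= tauD x)%E], continuous (flow t)}.
    apply: continuous_subspaceT => x; apply: (flow_cvg ids) => //.
    + exact: nearW.
    + exact: cvg_cst.
  apply: subspace_eq_continuous (within_continuous_comp ct cf _).
    by move=> x; rewrite inE => -[Ox tx] /=; have [] := gE x Ox tx.
  by move=> x [Ox tx]; have [] := gE x Ox tx.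
Qed.

Lemma glued_impulsive_semiflow t f : 0 <= t -> glued f -> glued (f \o phi t \o reset).
Proof.
move=> t0; have [d d0 small] : exists2 d : R, 0 < d &
    forall y, (I @` (Omega `&` D)) y -> (d%:E < tau1 y)%E.
  apply: (compact_lt_tau1 ids compact_reset_impulse).
  by move=> y /invI[].
pose n := Num.truncn (t / d).
have {small} small y : (I @` (Omega `&` D)) y -> ((t / n.+1%:R)%:E < tau1 y)%E.
  move=> /small; apply: le_lt_trans; rewrite lee_fin ler_pdivrMr// mulrC.
  by rewrite -ler_pdivrMr// ltW// truncnS_gt.
(* t is cut into n.+1 steps, each shorter than d. *)
set s := t / n.+1%:R in small.
have s0 : 0 <= s by rewrite divr_ge0.
have -> : t = s *+ n.+1 by rewrite -mulr_natr divfK// pnatr_eq0.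
elim: n.+1 f => [|k ih] f gf.
  apply: (eq_glued _ gf) => x Ox /=; rewrite mulr0n (impulsive_semiflow0 ids).
  by rewrite (glued_reset gf Ox).
apply: eq_glued (glued_impulsive_semiflow_small s0 small (ih f gf)) => x Ox /=.
have [_ nD] := nonwandering_setD_invariant ids invI s0 (reset_nonwandering Ox).
by rewrite (reset_out nD) mulrSr (impulsive_semiflowD ids)// mulrn_wge0.
Qed.

(** Let h vanish exactly on K. The function h itself may not be glued, so it is
    interpolated near D with its value h (I (next_hit x)) at the next jump. The
    weight w of h vanishes on D and equals 1 once tauD is at least d; with d small
    this includes K and the image of I. *)
Lemma glued_zero_set (K : set X) : closed K -> K `<=` Omega `\` D ->
  exists2 f, glued f & forall x, (Omega `\` D) x -> f x <= 0 <-> K x.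
Proof.
move=> cK KY.
have [d d0 small] : exists2 d : R, 0 < d &
    forall y, (K `|` I @` (Omega `&` D)) y -> (d%:E < tau1 y)%E.
  apply: (compact_lt_tau1 ids).
    apply: compactU compact_reset_impulse.
    exact: (subclosed_compact cK cX).
  by move=> y [/KY[]//|/invI[]].
have [h [ch h0 hK]] := closed_zero_set cK.
pose w x := cap d (tauD x) / d.
have w1 x : (d%:E <= tauD x)%E -> w x = 1.
  by move=> dx; rewrite /w cap_ge// divff// gt_eqF.
have w0 x : D x -> w x = 0.
  by move=> Dx; rewrite /w tauD_in// cap_fin min_l ?ltW// mul0r.
have wge0 x : 0 <= w x by rewrite divr_ge0 ?(ltW d0)// cap_ge0 ?tauD_ge0 ?(ltW d0).
have wle1 x : w x <= 1.
  rewrite ler_pdivrMr// mul1r; have [dx|/ltW xd] := leP d%:E (tauD x).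
    by rewrite cap_ge.
  by rewrite /cap min_l// -lee_fin fineK// ge0_fin_numE ?tauD_ge0// (le_lt_trans xd)// ltry.
have cw : {within Omega, continuous w}.
  apply/subspace_continuousP => x Ox; apply: cvgMl.
  apply: cvg_cap; first by rewrite gt_eqF// (lt_le_trans _ (tauD_ge0 x))// ltNyr.
  by have /subspace_continuousP := tauc; apply.
pose f x := w x * h x + (1 - w x) * h (I (next_hit x)).
exists f; last first.
  move=> x [Ox nDx]; split => [fx|Kx]; last first.
    have dx : (d%:E <= tauD x)%E by rewrite tauD_out// ltW// small//; left.
    by rewrite /f w1// subrr mul0r addr0 mul1r; have /hK -> := Kx.
  apply/hK/eqP; rewrite eq_le h0 andbT.
  have wx : 0 < w x.
    by rewrite divr_gt0// cap_gt0// tauD_out// (tau1_gt0 ids).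
  rewrite -(pmulr_rle0 _ wx); apply: le_trans fx.
  by rewrite lerDl mulr_ge0// subr_ge0.
split; last first.
  move=> x Ox Dx; have Kx : (I @` (Omega `&` D)) (I x) by exists x.
  have [_ nDx] := invI Kx.
  rewrite /f (w0 x)// w1; last by rewrite tauD_out// ltW// small//; right.
  by rewrite subrr mul0r addr0 mul1r mul0r add0r subr0 mul1r next_hit_in.
have -> : Omega = (Omega `&` [set x | (tauD x <= d%:E)%E]) `|`
                  (Omega `&` [set x | (d%:E <= tauD x)%E]).
  apply/seteqP; split => [x Ox|x [[]|[]]//].
  by have [xt|/ltW tx] := leP (tauD x) d%:E; [left|right].
apply: withinU_continuous; [exact: closed_tauD_le|exact: closed_tauD_ge| |].
- apply/subspace_continuousP => x Ax.
  have cwA : w @ within (Omega `&` [set x | (tauD x <= d%:E)%E]) (nbhs x) --> w x.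
    have AO : Omega `&` [set x | (tauD x <= d%:E)%E] `<=` Omega by move=> y [].
    by have /subspace_continuousP := continuous_subspaceW AO cw; apply.
  apply: cvgD; apply: cvgM => //.
  + by apply: cvg_trans (ch x); apply: cvg_app; exact: cvg_within.
  + by apply: cvgB => //; exact: cvg_cst.
  + have /subspace_continuousP := continuous_reset_next_hit (t := d).
    by move=> /(_ x Ax) cx; apply: (cvg_comp _ _ cx); exact: ch.
- apply: (@subspace_eq_continuous _ _ _ h).
    by move=> x; rewrite inE => -[Ox dx]; rewrite /from_subspace /f w1// subrr mul0r addr0 mul1r.
  exact: continuous_subspaceT.
Qed.

End gluing.

(** * Existence of an invariant probability *)

Section sublevel_sets.
Context {R : realType} {X : pmetricType R}.
Variables (m : set X -> R) (nu : probability (borel X) R) (F : set X).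
Hypothesis mP : mean m.
Hypothesis nu_le : forall U : set X, open U -> (nu U <= (m U)%:E)%E.
Hypothesis cF : closed F.
Hypothesis mF : m F = 1.

Lemma mean_le_closed K : closed K -> ((m K)%:E <= nu K)%E.
Proof.
move=> cK; have := nu_le (closed_openC cK).
rewrite (probability_setC nu (borel_closed cK)) mean_setC// EFinB.
have : nu K \is a fin_num by exact: fin_num_measure (borel_closed cK).
by case: (nu K) => [r _| |]//; rewrite -!EFinB !lee_fin; lra.
Qed.

Lemma nu_carrier : nu F = 1%E.
Proof.
apply/eqP; rewrite eq_le (probability_le1 nu (borel_closed cF))/=.
by have := mean_le_closed cF; rewrite mF.
Qed.

Let le_sublevel (f g : X -> R) a :
  {within F, continuous f} -> {within F, continuous g} ->
  (forall b, m (F `&` [set x | g x < b]) <= m (F `&` [set x | f x < b])) ->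
  (nu (F `&` [set x | (g x <= a)%R]) <= nu (F `&` [set x | (f x <= a)%R]))%E.
Proof.
move=> cf cg mgf.
have csub (h : X -> R) (b : R) : {within F, continuous h} -> closed (F `&` [set x | h x <= b]).
  move=> ch; exact: (@closed_within_preimage _ _ F [set y | y <= b] h cF ch (@closed_le _ _)).
pose G n := F `&` [set x | f x <= a + n.+1%:R^-1].
have cG n : closed (G n) by exact: csub.
have GE : \bigcap_n G n = F `&` [set x | f x <= a].
  apply/seteqP; split => [x Gx|x [Fx fx] n _]; last first.
    by split => //=; rewrite (le_trans fx)// lerDl invr_ge0.
  have [Fx _] := Gx 0%N I; split=> //=; apply/ler_addgt0Pr => e e0.
  have [n _ /(_ n (leqnn n)) /= ne] := near_infty_natSinv_lt (PosNum e0).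
  by have [_ /= /le_trans->//] := Gx n I; rewrite lerD2l ltW.
have nuG : nu (G n) @[n --> \oo] --> nu (\bigcap_n G n).
  apply: nonincreasing_cvg_mu.
  - by rewrite (le_lt_trans (probability_le1 _ _))// ?ltry//; exact: borel_closed.
  - by move=> n; exact: borel_closed.
  - by rewrite GE; apply: borel_closed; exact: csub.
  - move=> n k nk; apply/subsetPset => x [Fx /= fx]; split => //=.
    by rewrite (le_trans fx)// lerD2l lef_pV2 ?posrE// ler_nat.
have limG : limn (fun n => nu (G n)) = nu (\bigcap_n G n) by exact: cvg_lim.
rewrite -GE -limG; apply: lime_ge; first exact: (cvgP _ nuG).
apply: nearW => n; set b := a + n.+1%:R^-1.
have ab : a < b by rewrite ltrDl invr_gt0.
(* [g < b] is open in F only; U is an open set of X with the same trace on F. *)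
pose U := ~` (F `&` [set x | b <= g x]).
have oU : open U.
  apply: closed_openC.
  exact: (@closed_within_preimage _ _ F [set y | b <= y] g cF cg (@closed_ge _ _)).
apply: (@le_trans _ _ (nu U)).
  apply: le_measure; rewrite ?inE; [by apply: borel_closed; exact: csub|exact: borel_open|].
  by move=> x [Fx /= ga] [_ /=]; rewrite leNgt (le_lt_trans ga ab).
apply: (le_trans (nu_le oU)); apply: (@le_trans _ _ (m (G n))%:E); last exact: mean_le_closed.
rewrite lee_fin -(mean_setIr mP U mF).
apply: (@le_trans _ _ (m (F `&` [set x | g x < b]))).
  by apply: (le_mean mP) => x [nx Fx]; split => //=; rewrite ltNge; apply/negP => bg; exact: nx.
by rewrite (le_trans (mgf b))// (le_mean mP)// => x [Fx /= /ltW].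
Qed.

(** Weak convergence in terms of level sets: if g and f have the same distribution
    under the mean m, they have the same distribution under nu. Indeed, for b > a,
    nu [g <= a] <= m [g < b] = m [f < b] <= nu [f <= b], and b tends to a. *)
Lemma eq_sublevel (f g : X -> R) a :
  {within F, continuous f} -> {within F, continuous g} ->
  (forall b, m (F `&` [set x | g x < b]) = m (F `&` [set x | f x < b])) ->
  nu (F `&` [set x | (g x <= a)%R]) = nu (F `&` [set x | (f x <= a)%R]).
Proof.
move=> cf cg mgf; apply/eqP; rewrite eq_le; apply/andP; split.
  by apply: le_sublevel => // b; rewrite mgf.
by apply: le_sublevel => // b; rewrite mgf.
Qed.

End sublevel_sets.

Section pushforward_probability.
Context {R : realType} {d1 d2 : measure_display} {T1 : measurableType d1}
  {T2 : measurableType d2}.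

Lemma pushforward_probability (mu : probability T1 R) (f : T1 -> T2) :
  measurable_fun setT f ->
  exists nu : probability T2 R, forall A, nu A = mu (f @^-1` A).
Proof.
move=> mf; pose f' := HB.pack_for {mfun T1 >-> T2} f (isMeasurableFun.Build _ _ _ _ f mf).
by exists (distribution mu f').
Qed.

End pushforward_probability.

Section existence.
Context {R : realType} {X : pmetricType R}.
Variables (flow : R -> X -> X) (D : set X) (I : X -> X).
Hypothesis cX : compact [set: X].
Hypothesis ids : impulsive_dynamical_system flow D I.
Notation tauD := (tauD flow D).
Notation phi := (impulsive_semiflow flow D I).
Notation Omega := (nonwandering phi).
Notation reset := (reset D I).
Hypothesis tauc : {within Omega, continuous tauD}.
Hypothesis invI : I @` (Omega `&` D) `<=` Omega `\` D.

Lemma measurable_reset : @measurable_fun _ _ (borel X) (borel X) setT reset.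
Proof.
have mD := borel_closed (closed_impulse_set ids).
have preD : (fun x => x \in D) @^-1` [set true] = D.
  by apply/seteqP; split => x /=; [move/set_mem|move/mem_set].
apply: (@measurable_fun_if _ _ (borel X) (borel X)) => //.
- apply: (@measurable_fun_bool _ (borel X) _ _ true).
  by rewrite setTI preD.
- by rewrite setTI preD; exact: (measurable_impulse ids).
Qed.

(** The mean m is taken along the orbit of a point of Y, and mu is the image of nu
    under reset. For K closed in Y and f glued with K the trace of [f <= 0] on Y,
    both mu K = nu [f <= 0] and mu (phi_t^-1 K) = nu [g <= 0] for
    g = f \o phi t \o reset. *)
Lemma invariant_probability_exists :
  exists mu : probability (borel X) R, invariant_probability phi mu.
Proof.
have cO : closed Omega := @closed_nonwandering _ _ phi.
have cD := closed_impulse_set ids.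
have mphi := impulsive_semiflow_measurable cX ids.
have mphit t : 0 <= t -> @measurable_fun _ _ (borel X) (borel X) setT (phi t).
  exact: measurable_time_map.
have Yinv t x := @nonwandering_setD_invariant _ _ _ _ _ ids invI t x.
have [p Op] := nonwandering_nonempty cX (impulsive_semiflowD ids).
have x0Y := reset_nonwandering invI Op.
have phiC (s t : R) x : phi `|s| (phi `|t| x) = phi `|t| (phi `|s| x).
  by rewrite -!(impulsive_semiflowD ids)// addrC.
(* Absolute values index the times t >= 0 by all reals. *)
have [m [mP minv mfull]] := @invariant_mean R _ _ (fun t : R => phi `|t|) phiC (reset p).
have mY : m (Omega `\` D) = 1 by apply: mfull => // t x; exact: Yinv.
have mO : m Omega = 1.
  apply/eqP; rewrite eq_le (mean_le1 mP)/= -mY; apply: (le_mean mP).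
  by move=> x [].
have [nu nu_le] := borel_probability_of_mean cX mP.
have nuO : nu Omega = 1%E by exact: nu_carrier mP nu_le cO mO.
have [mu muE] := pushforward_probability nu measurable_reset.
exists mu; split => // A t mA t0.
have [mut mutE] := pushforward_probability mu (mphit t t0).
have mO' := borel_closed cO.
have mYb : measurable (Omega `\` D : set (borel X)).
  by apply: measurableD => //; exact: borel_closed.
have preim (s : R) (B : set (borel X)) : measurable B -> 0 <= s ->
    measurable (phi s @^-1` B : set (borel X)).
  by move=> mB s0; rewrite -[X in measurable X]setTI; exact: (mphit s s0).
have premreset (B : set (borel X)) : measurable B ->
    measurable (reset @^-1` B : set (borel X)).
  by move=> mB; rewrite -[X in measurable X]setTI; exact: measurable_reset.
have nuE (B C : set (borel X)) : measurable B -> measurable C ->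
    B `&` Omega = C `&` Omega -> nu B = nu C.
  by move=> mB mC BC; rewrite -(probability_setIr mB mO' nuO) BC probability_setIr.
have carried (B : set (borel X)) : measurable B -> (Omega `<=` B) -> nu B = 1%E.
  move=> mB OB; rewrite -(probability_setT nu); apply: nuE => //.
  by rewrite setTI; apply/setIidPr.
rewrite -mutE.
apply: (probability_unique_closed_setD cO cD) mA.
- rewrite mutE muE; apply: carried; first by apply: premreset; exact: preim.
  by move=> x Ox; apply: Yinv => //; exact: reset_nonwandering.
- by rewrite muE; apply: carried => [|x Ox]; [exact: premreset|exact: reset_nonwandering].
move=> K cK KY; have mK := borel_closed cK.
have [f gf fK] := glued_zero_set cX ids tauc invI cK KY.
have gg := glued_impulsive_semiflow ids tauc invI t0 gf.
set g := f \o phi t \o reset in gg.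
have := @eq_sublevel _ _ m nu Omega mP nu_le cO mO f g 0 (proj1 gf) (proj1 gg).
(* On Y, which has full mean, reset is the identity, so g = f \o phi t there. *)
have msub (b : R) : m (Omega `&` [set x | g x < b]) = m (Omega `&` [set x | f x < b]).
  rewrite -[RHS](minv t) ger0_norm// -(mean_setIr mP _ mY) -[RHS](mean_setIr mP _ mY).
  congr (m _); apply/seteqP; split => x [] /=.
    move=> [Ox gxb] Yx; split => //; split; first by have [] := Yinv t x t0 Yx.
    by move: gxb; rewrite /g/= reset_out//; have [] := Yx.
  move=> [Ox fxb] Yx; split => //; split; first by have [] := Yx.
  by rewrite /g/= reset_out//; have [] := Yx.
move=> /(_ msub) nufg.
have csub (h : X -> R) : {within Omega, continuous h} ->
    measurable (Omega `&` [set x | h x <= 0] : set (borel X)).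
  move=> ch; apply: borel_closed.
  have cle : closed [set y : R | y <= 0] by exact: closed_le.
  exact: (closed_within_preimage cO ch cle).
rewrite mutE !muE; transitivity (nu (Omega `&` [set x | g x <= 0])).
  apply: nuE; [by apply: premreset; apply: preim|exact: csub (proj1 gg)|].
  apply/seteqP; split => x /= [].
    by move=> Kx Ox; do 2!split => //; apply/fK => //; apply: Yinv => //; exact: reset_nonwandering.
  move=> [Ox gx] _; split => //; apply/fK => //.
  by apply: Yinv => //; exact: reset_nonwandering.
rewrite nufg; apply: nuE; [exact: csub (proj1 gf)|exact: premreset|].
apply/seteqP; split => x /= [].
  move=> [Ox fx] _; split => //; apply/fK; first exact: reset_nonwandering.
  by rewrite (glued_reset gf Ox).
move=> Kx Ox; do 2!split => //; rewrite /= -(glued_reset gf Ox).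
by apply/fK => //; exact: reset_nonwandering.
Qed.

End existence.

Theorem theorem1 (R : realType) (X : pmetricType R)
    (flow : R -> X -> X) (D : set X) (I : X -> X)
    (phi := impulsive_semiflow flow D I) (Omega := nonwandering phi) :
  compact [set: X] ->
  impulsive_dynamical_system flow D I ->
  {within Omega, continuous (tauD flow D)} ->
  I @` (Omega `&` D) `<=` Omega `\` D ->
  (exists mu : probability (borel X) R, invariant_probability phi mu) /\
  (forall mu : probability (borel X) R, invariant_probability phi mu ->
     measure_support mu `<=` Omega /\ mu D = 0%E).
Proof.
move=> cX ids tauc invI; split; first exact: invariant_probability_exists.
move=> mu muP; split; first exact: measure_support_nonwandering.
exact: measure_impulse_set muP.
Qed.
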